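(* Let $A\in\mathbb{R}^{n\times n}$, $B\in\mathbb{R}^{n\times m}$, $C\in\mathbb{R}^{p\times n}$, $D\in\mathbb{R}^{p\times m}$, $E\in\mathbb{R}^{q\times n}$, $F\in\mathbb{R}^{q\times m}$, and consider the linear time-invariant system $$\Sigma:\quad \dot x=Ax+Bu,\qquad y=Cx+Du,\qquad z=Ex+Fu .$$ Define the polynomial matrices $$P(s)=\begin{bmatrix} sI_n-A & -B\\ C & D\end{bmatrix},\qquad P_e(s)=\begin{bmatrix} sI_n-A & -B\\ C & D\\ E & F\end{bmatrix}.$$ Then $\Sigma$ is strongly functional detectable if and only if both of the following hold: (1) $\mathrm{normrank}\,P=\mathrm{normrank}\,P_e$; (2) $\mathcal{Z}_{\mathrm{inv}}^+(P)=\mathcal{Z}_{\mathrm{inv}}^+(P_e)$ (equality counting multiplicities).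
   Context: State $x\in\mathbb{R}^n$, initial state $x(0)$, input $u\in\mathbb{R}^m$, measured output $y\in\mathbb{R}^p$, output to be estimated $z\in\mathbb{R}^q$. All signals are impulsive-smooth distributions on $[0,\infty)$, i.e. sums of a function smooth on $[0,\infty)$ and a finite linear combination of the Dirac distribution at $0$ and its derivatives; for $t>0$, $y(t)$ and $z(t)$ denote the values of the smooth parts. $\Sigma$ is *strongly functional detectable* if for any initial state $x(0)$ and any input $u$: if $y(t)=0$ for all $t>0$, then $z(t)\to 0$ as $t\to\infty$. For a polynomial (or rational) matrix $M$, $\mathrm{normrank}\,M=\max_{s\in\mathbb{C}}\mathrm{rank}\,M(s)$. The invariant zeros of a polynomial matrix $M$ are the zeros of the nontrivial invariant polynomials in the diagonal Smith form of $M$; thus $s_0\in\mathbb{C}$ is an invariant zero iff $\mathrm{rank}\,M(s_0)<\mathrm{normrank}\,M$. $\mathcal{Z}_{\mathrm{inv}}(M)$ is the set of invariant zeros counted with multiplicities (a multiset, the multiplicity of $s_0$ being its total multiplicity as a root of the product of the invariant polynomials). $\mathbb{C}^+$ is the set of complex numbers with nonnegative real part, and $\mathcal{Z}_{\mathrm{inv}}^+(M)=\mathcal{Z}_{\mathrm{inv}}(M)\cap\mathbb{C}^+$. *)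

(* Defs.v *)
(* MathComp + MathComp-Analysis, with R[i] from mathcomp-real-closed. *)
From HB Require Import structures.
From mathcomp Require Import all_boot all_order all_algebra.
From mathcomp Require Import all_classical all_reals all_analysis.
From mathcomp Require Import complex.

Set Implicit Arguments.
Unset Strict Implicit.
Unset Printing Implicit Defensive.

Import Order.TTheory GRing.Theory Num.Theory.
Import numFieldNormedType.Exports.

Local Open Scope classical_set_scope.
Local Open Scope ring_scope.
Local Open Scope complex_scope.

(* The derivative is relative to [0, +oo[, hence one-sided at t = 0; values at
   negative times are irrelevant. *)
Definition deriv_ge0 (R : realType) (k : nat) (f g : R -> 'cV[R]_k) : Prop :=
  forall t : R, 0 <= t ->
    h^-1 *: (f (t + h) - f t) @[h --> within [set h | 0 <= t + h] (0 : R)^']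
      --> g t.

(* [G j] is the j-th derivative of [f] on [0, +oo[. *)
Definition smooth_ge0 (R : realType) (k : nat) (f : R -> 'cV[R]_k) : Prop :=
  exists G : nat -> R -> 'cV[R]_k,
    G 0%N = f /\ forall j, deriv_ge0 (G j) (G j.+1).

(* The R^k-valued distribution f + sum_j c_j delta^(j) supported in [0, +oo[,
   where f is [reg], extended by 0 to negative times, and c_j is the vector of
   coefficients of 'X^j in [imp]. The values of [reg] at negative times carry no
   meaning, and equality of distributions is [sig_eq]. *)
Record signal (R : realType) (k : nat) := Signal {
  reg : R -> 'cV[R]_k;
  imp : 'cV[{poly R}]_k
}.

Definition impulsive_smooth (R : realType) (k : nat) (f : signal R k) : Prop :=
  smooth_ge0 (reg f).

Definition sig_eq (R : realType) (k : nat) (f g : signal R k) : Prop :=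
  (forall t : R, 0 <= t -> reg f t = reg g t) /\ imp f = imp g.

Definition sig_add (R : realType) (k : nat) (f g : signal R k) : signal R k :=
  Signal (fun t => reg f t + reg g t) (imp f + imp g).

Definition sig_mul (R : realType) (l k : nat) (M : 'M[R]_(l, k))
    (f : signal R k) : signal R l :=
  Signal (fun t => M *m reg f t) (map_mx polyC M *m imp f).

(* v delta *)
Definition sig_dirac (R : realType) (k : nat) (v : 'cV[R]_k) : signal R k :=
  Signal (fun=> 0) (map_mx polyC v).

(* [g] is the distributional derivative of [f]: the jump of the regular part at
   0 gives (f 1_[0,+oo[)' = f' 1_[0,+oo[ + f(0) delta, and differentiation sends
   delta^(j) to delta^(j+1). *)
Definition sig_deriv (R : realType) (k : nat) (f g : signal R k) : Prop :=
  deriv_ge0 (reg f) (reg g) /\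
  imp g = 'X *: imp f + map_mx polyC (reg f 0).

(* For distributions supported in [0, +oo[, the equation x' = A x + B u with
   initial state x0 = x(0-) reads x' = A x + B u + x0 delta. *)
Definition trajectory (R : realType) (n m p q : nat)
    (A : 'M[R]_n) (B : 'M[R]_(n, m)) (C : 'M[R]_(p, n)) (D : 'M[R]_(p, m))
    (E : 'M[R]_(q, n)) (F : 'M[R]_(q, m)) (x0 : 'cV[R]_n)
    (u : signal R m) (x : signal R n) (y : signal R p) (z : signal R q) : Prop :=
  [/\ [/\ impulsive_smooth u, impulsive_smooth x,
          impulsive_smooth y & impulsive_smooth z],
      sig_deriv x (sig_add (sig_add (sig_mul A x) (sig_mul B u)) (sig_dirac x0)),
      sig_eq y (sig_add (sig_mul C x) (sig_mul D u)) &
      sig_eq z (sig_add (sig_mul E x) (sig_mul F u))].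

Definition strongly_functional_detectable (R : realType) (n m p q : nat)
    (A : 'M[R]_n) (B : 'M[R]_(n, m)) (C : 'M[R]_(p, n)) (D : 'M[R]_(p, m))
    (E : 'M[R]_(q, n)) (F : 'M[R]_(q, m)) : Prop :=
  forall (x0 : 'cV[R]_n) (u : signal R m)
         (x : signal R n) (y : signal R p) (z : signal R q),
    trajectory A B C D E F x0 u x y z ->
    (forall t : R, 0 < t -> reg y t = 0) ->
    reg z t @[t --> +oo] --> (0 : 'cV[R]_q).

Definition eval_mx (R : realType) (k l : nat) (M : 'M[{poly R}]_(k, l))
    (s : R[i]) : 'M[R[i]]_(k, l) :=
  map_mx (fun a : {poly R} => (map_poly (real_complex R) a).[s]) M.

Definition normrank (R : realType) (k l : nat) (M : 'M[{poly R}]_(k, l)) : nat :=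
  (\max_(r < l.+1 | `[< exists s : R[i], \rank (eval_mx M s) = r >]) r)%N.

(* [d] lists the invariant polynomials d_1 | d_2 | ... | d_r of M, all monic
   (those equal to 1 included); the remaining diagonal entries of the Smith form
   are 0, which is the default value of d`_i. *)
Definition is_smith (R : realType) (k l : nat) (M : 'M[{poly R}]_(k, l))
    (d : seq {poly R}) : Prop :=
  exists (U : 'M[{poly R}]_k) (V : 'M[{poly R}]_l),
    [/\ U \in unitmx, V \in unitmx,
        U *m M *m V = \matrix_(i, j) (if i == j :> nat then d`_i else 0),
        (size d <= minn k l)%N &
        all (fun a => a \is monic) d && sorted (@dvdp R) d].

(* The Smith form always exists and is unique, so the default value is never
   used. *)
Definition invariant_polys (R : realType) (k l : nat)
    (M : 'M[{poly R}]_(k, l)) : seq {poly R} :=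
  xget [::] [set d | is_smith M d].

(* Multisets of complex numbers are given by their multiplicity functions. *)
Definition Zinv (R : realType) (k l : nat) (M : 'M[{poly R}]_(k, l))
    (s : R[i]) : nat :=
  mup s (map_poly (real_complex R) (\prod_(a <- invariant_polys M) a)).

Definition Zinv_plus (R : realType) (k l : nat) (M : 'M[{poly R}]_(k, l))
    (s : R[i]) : nat :=
  if 0 <= complex.Re s then Zinv M s else 0%N.

(* [char_poly_mx A] is 'X%:M - A. *)
Definition sysP (R : realType) (n m p : nat) (A : 'M[R]_n) (B : 'M[R]_(n, m))
    (C : 'M[R]_(p, n)) (D : 'M[R]_(p, m)) : 'M[{poly R}]_(n + p, n + m) :=
  block_mx (char_poly_mx A)  (- map_mx polyC B)
           (map_mx polyC C)  (map_mx polyC D).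

Definition sysPe (R : realType) (n m p q : nat) (A : 'M[R]_n) (B : 'M[R]_(n, m))
    (C : 'M[R]_(p, n)) (D : 'M[R]_(p, m))
    (E : 'M[R]_(q, n)) (F : 'M[R]_(q, m)) : 'M[{poly R}]_(n + p + q, n + m) :=
  col_mx (sysP A B C D) (row_mx (map_mx polyC E) (map_mx polyC F)).

(* Main.v *)
(* Only the regular parts matter: impulses at 0 never enter for t > 0, and every
   smooth solution of x' = A x + B u, 0 = C x + D u is a trajectory without
   impulses, started at x(0). Let U P V = diag(d_1, ..., d_r, 0, ...) be the Smith form
   and H = [E F] V. With w = V^-1 (x; u) the equations decouple into
   d_i(d/dt) w_i = 0 for i <= r, with w_i free for i > r, and z = H(d/dt) w. Hence
   detectability says that H_ij = 0 for j > r, and that for j <= r every s with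
   Re s >= 0 is a root of H_ij of multiplicity at least that in d_j (the modes
   t^k e^(st) have to be annihilated, the modes with Re s < 0 decay).
   The first condition is the equality of the normal ranks. Under it the second one
   is the equality of the multiplicities of s in d_1 ... d_r and in the invariant
   polynomials of P_e, because P_e is equivalent to the column of diag(d) and H. *)
From HB Require Import structures.
Require Import Defs.
From mathcomp Require Import all_boot all_order all_algebra perm.
From mathcomp Require Import all_classical all_reals all_analysis.
From mathcomp Require Import complex zify ring lra.

Set Implicit Arguments.
Unset Strict Implicit.
Unset Printing Implicit Defensive.

Import Order.TTheory GRing.Theory Num.Theory.
Import numFieldNormedType.Exports.

Local Open Scope classical_set_scope.
Local Open Scope ring_scope.
Local Open Scope complex_scope.

(** * Smith form *)

Definition unimodular_eqv (K : comUnitRingType) k l (M N : 'M[K]_(k, l)) : Prop :=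
  exists U V, [/\ U \in unitmx, V \in unitmx & U *m M *m V = N].

Lemma unimodular_eqv_trans (K : comUnitRingType) k l (N M L : 'M[K]_(k, l)) :
  unimodular_eqv M N -> unimodular_eqv N L -> unimodular_eqv M L.
Proof.
move=> [U [V [uU uV <-]]] [U' [V' [uU' uV' <-]]].
by exists (U' *m U), (V *m V'); rewrite !unitmx_mul uU uV uU' uV' !mulmxA.
Qed.

Lemma unimodular_eqv_tr (K : comUnitRingType) k l (M N : 'M[K]_(k, l)) :
  unimodular_eqv M N -> unimodular_eqv M^T N^T.
Proof.
move=> [U [V [uU uV <-]]].
by exists V^T, U^T; rewrite !unitmx_tr uU uV !trmx_mul mulmxA.
Qed.

Lemma unimodular_eqv_l (K : comUnitRingType) k l (M : 'M[K]_(k, l)) U :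
  U \in unitmx -> unimodular_eqv M (U *m M).
Proof. by move=> uU; exists U, 1%:M; rewrite uU unitmx1 mulmx1. Qed.

Lemma unimodular_eqv_r (K : comUnitRingType) k l (M : 'M[K]_(k, l)) V :
  V \in unitmx -> unimodular_eqv M (M *m V).
Proof. by move=> uV; exists 1%:M, V; rewrite uV unitmx1 mul1mx. Qed.

Lemma unimodular_eqv_swap (K : comUnitRingType) k l (M : 'M[K]_(1 + k, 1 + l)) i j :
  exists2 N, unimodular_eqv M N & N 0 0 = M i j.
Proof.
exists (xrow 0 i (xcol 0 j M)); last by rewrite !mxE !tpermL.
apply: (@unimodular_eqv_trans _ _ _ (xcol 0 j M)).
  by rewrite xcolE; apply: unimodular_eqv_r; rewrite unitmx_perm.
by rewrite xrowE; apply: unimodular_eqv_l; rewrite unitmx_perm.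
Qed.

Lemma unitmx_ublock1 (K : comUnitRingType) k l (u : 'M[K]_(k, l)) :
  block_mx 1%:M u 0 1%:M \in unitmx.
Proof. by rewrite unitmxE det_ublock !det1 mul1r unitr1. Qed.

Lemma unitmx_lblock1 (K : comUnitRingType) k l (u : 'M[K]_(k, l)) :
  block_mx 1%:M 0 u 1%:M \in unitmx.
Proof. by rewrite unitmxE det_lblock !det1 mul1r unitr1. Qed.

Section Smith.
Variable F : fieldType.
Implicit Types (k l : nat).

(** One step of the Smith reduction. Divisibility of the remaining block by the pivot is included
    because it yields the chain d_1 | d_2 | ... in the recursion. *)
Definition smith_pivot k l (M : 'M[{poly F}]_(1 + k, 1 + l)) : Prop :=
  exists a (M' : 'M[{poly F}]_(k, l)),
    [/\ a \is monic, forall i j, a %| M' i j &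
        unimodular_eqv M (block_mx a%:M 0 0 M')].

Lemma smith_pivot_tr k l (M : 'M[{poly F}]_(1 + k, 1 + l)) :
  smith_pivot M^T -> smith_pivot M.
Proof.
move=> [a [M' [ma aM' eM]]]; exists a, M'^T.
split=> // [i j|]; first by rewrite mxE.
move: eM => /unimodular_eqv_tr.
by rewrite trmxK (tr_block_mx a%:M) !trmx0 tr_scalar_mx.
Qed.

Lemma smith_pivot_eqv k l (M N : 'M[{poly F}]_(1 + k, 1 + l)) :
  unimodular_eqv M N -> smith_pivot N -> smith_pivot M.
Proof.
move=> eMN [a [M' [ma aM' eN]]]; exists a, M'; split=> //.
exact: unimodular_eqv_trans eN.
Qed.

(* Induction on the size of the pivot: an entry of its row or column which it does
   not divide leaves a smaller remainder; once the row and the column are cleared,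
   any other such entry is first moved into the row of the pivot. *)
Lemma smith_pivot_small n k l (M : 'M[{poly F}]_(1 + k, 1 + l)) :
  M 0 0 != 0 -> (size (M 0%R 0%R) <= n)%N -> smith_pivot M.
Proof.
elim: n k l M => [|n IHn] k l M M0; first by rewrite leqn0 size_poly_eq0 (negbTE M0).
move=> szM.
(* The dimensions are general because the claim also serves the transpose, for the column of the
   pivot. *)
have row_case k' l' (N : 'M[{poly F}]_(1 + k', 1 + l')) (j : 'I_l') :
    N 0 0 != 0 -> (size (N 0%R 0%R) <= n.+1)%N ->
    ~~ (N 0 0 %| N 0 (rshift 1 j)) -> smith_pivot N.
  move=> N0 szN ndv.
  (* Right multiplication by [V] subtracts a multiple of the first column from column [j], leaving
     the remainder in the pivot row; a swap makes it the new pivot. *)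
  pose V : 'M[{poly F}]_(1 + l') :=
    block_mx 1%:M (- (N 0 (rshift 1 j) %/ N 0 0) *: delta_mx 0 j) 0 1%:M.
  have eNV : unimodular_eqv N (N *m V) by exact/unimodular_eqv_r/unitmx_ublock1.
  have [N' eN' N'0] := unimodular_eqv_swap (N *m V) 0 (rshift 1 j).
  have N'E : N' 0 0 = N 0 (rshift 1 j) %% N 0 0.
    rewrite N'0 -{1}(submxK N) mulmx_block.
    have -> : (0 : 'I_(1 + k')) = lshift k' 0 by apply: val_inj.
    rewrite block_mxEur !mxE big_ord1 !mxE !eqxx mulr1.
    rewrite (bigD1 j) //= big1 => [|i /negbTE ij]; last by rewrite !mxE ij mulr0.
    rewrite !mxE eqxx mulr1 addr0 addrC; apply/eqP; rewrite mulrN subr_eq.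
    have -> : lshift l' (0 : 'I_1) = 0 by apply: val_inj.
    by rewrite [X in _ == _ + X]mulrC addrC -divp_eq.
  apply: (smith_pivot_eqv (unimodular_eqv_trans eNV eN')); apply: IHn; rewrite N'E //.
  by rewrite -ltnS (leq_trans _ szN) // ltn_modp.
have [/existsP[j ndv]|] := boolP [exists j, ~~ (M 0 0 %| M 0 (rshift 1 j))].
  exact: row_case ndv.
rewrite negb_exists => /forallP rowM.
have [/existsP[i ndv]|] := boolP [exists i, ~~ (M 0 0 %| M (rshift 1 i) 0)].
  by apply/smith_pivot_tr/(row_case _ _ _ i); rewrite !mxE.
rewrite negb_exists => /forallP colM.
pose a := M 0 0; pose u : 'rV_l := \row_j (M 0 (rshift 1 j) %/ a).
pose v : 'cV_k := \col_i (M (rshift 1 i) 0 %/ a).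
have M00 : ulsubmx M = a%:M.
  apply/matrixP=> i j; rewrite !mxE !ord1 eqxx /a.
  by congr (M _ _); apply: val_inj.
have Mu : ursubmx M = a *: u.
  apply/matrixP=> i j; rewrite !mxE ord1 mulrC divpK; last exact/negPn/rowM.
  by congr (M _ _); apply: val_inj.
have Mv : dlsubmx M = a *: v.
  apply/matrixP=> i j; rewrite !mxE ord1 mulrC divpK; last exact/negPn/colM.
  by congr (M _ _); apply: val_inj.
(* The Schur complement of the pivot, free of division because the row and the column are the
   multiples [a *: u] and [a *: v]. *)
pose M1 := drsubmx M - a *: (v *m u).
have eM : unimodular_eqv M (block_mx a%:M 0 0 M1).
  exists (block_mx 1%:M 0 (- v) 1%:M), (block_mx 1%:M (- u) 0 1%:M).
  rewrite unitmx_lblock1 unitmx_ublock1 -{1}(submxK M) M00 Mu Mv.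
  rewrite !mulmx_block !mul1mx !mul0mx !addr0 !mulmx1 !mulmx0 !addr0.
  by rewrite mulNmx mul_mx_scalar addNr mul0mx add0r mulmxN mul_scalar_mx addNr
     mulNmx -scalemxAr addrC.
have [/existsP[i /existsP[j ndv]]|] := boolP [exists i, exists j, ~~ (a %| M1 i j)].
  apply: (smith_pivot_eqv eM).
  (* Adding row [i] of [M1] to the pivot row keeps the pivot, since the entries below it are
     zero. *)
  apply: (@smith_pivot_eqv _ _ _ (block_mx 1%:M (delta_mx 0 i) 0 1%:M *m
            block_mx a%:M 0 0 M1)); first exact/unimodular_eqv_l/unitmx_ublock1.
  rewrite mulmx_block !mul1mx !mul0mx !mulmx0 !addr0 !add0r -rowE.
  have z : (0 : 'I_(1 + l)) = lshift l 0 by apply: val_inj.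
  have z' : (0 : 'I_(1 + k)) = lshift k 0 by apply: val_inj.
  have Na : block_mx a%:M (row i M1) 0 M1 0 0 = a.
    by rewrite z z' block_mxEul mxE eqxx.
  apply: (row_case _ _ _ j); rewrite Na //.
  by rewrite z' block_mxEur mxE.
rewrite negb_exists => /forallP aM1.
exists ((lead_coef a)^-1 *: a), M1; split.
- by rewrite monicE lead_coefZ mulVf // lead_coef_eq0.
- move=> i j; rewrite dvdpZl ?invr_eq0 ?lead_coef_eq0 //.
  by have := aM1 i; rewrite negb_exists => /forallP/(_ j)/negPn.
- apply: (unimodular_eqv_trans eM).
  have -> : @block_mx _ 1 k 1 l ((lead_coef a)^-1 *: a)%:M 0 0 M1 =
     @block_mx _ 1 k 1 k (((lead_coef a)^-1)%:P)%:M 0 0 1%:M *m block_mx a%:M 0 0 M1.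
    rewrite mulmx_block !mul0mx !mulmx0 mul1mx !addr0 !add0r.
    by rewrite -scalar_mxM mul_polyC.
  apply: unimodular_eqv_l; rewrite unitmxE det_ublock det1 mulr1 det_scalar1.
  by rewrite poly_unitE size_polyC coefC eqxx unitfE invr_eq0 lead_coef_eq0 M0.
Qed.

Lemma smith_pivotP k l (M : 'M[{poly F}]_(1 + k, 1 + l)) : M != 0 -> smith_pivot M.
Proof.
move=> M0.
have /existsP[i /existsP[j Mij]] : [exists i, exists j, M i j != 0].
  apply: contraR M0; rewrite negb_exists => /forallP M0.
  apply/eqP/matrixP=> i j; rewrite mxE; apply/eqP.
  by have := M0 i; rewrite negb_exists => /forallP/(_ j)/negPn.
have [N eN N0] := unimodular_eqv_swap M i j.
by apply: (smith_pivot_eqv eN); apply: (@smith_pivot_small (size (M i j))); rewrite N0.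
Qed.

Definition diag_seq_mx k l (d : seq {poly F}) : 'M[{poly F}]_(k, l) :=
  \matrix_(i, j) (if i == j :> nat then d`_i else 0).

(** Recursion on the block left by the pivot. The pivot divides this block entrywise, hence also
    [U *m M' *m V], whose diagonal contains [d]; so prepending it preserves the divisor chain. *)
Lemma smith_form_exists k l (M : 'M[{poly F}]_(k, l)) :
  exists2 d, [/\ (size d <= minn k l)%N, all (mem monic) d & sorted (@dvdp F) d] &
    unimodular_eqv M (diag_seq_mx k l d).
Proof.
have zero_case k' l' : exists2 d,
    [/\ (size d <= minn k' l')%N, all (mem monic) d & sorted (@dvdp F) d] &
    unimodular_eqv 0 (diag_seq_mx k' l' d).
  exists [::] => //; exists 1%:M, 1%:M; rewrite !unitmx1 mulmx0 mul0mx; split=> //.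
  by apply/matrixP => i j; rewrite !mxE nth_nil if_same.
elim: k l M => [|k IHk] l M; first by rewrite [M]flatmx0; exact: zero_case.
case: l M => [|l] M; first by rewrite [M]thinmx0; exact: zero_case.
have [->|M0] := eqVneq M 0; first exact: zero_case.
have [a [M' [ma aM' eM]]] := smith_pivotP (M0 : (M : 'M[{poly F}]_(1 + k, 1 + l)) != 0).
have [d [szd md sd] [U [V [uU uV eM']]]] := IHk l M'.
exists (a :: d).
  split=> /=; first by rewrite minnSS ltnS.
    by rewrite md andbT.
  have ad : all (dvdp a) d.
    apply/(all_nthP 0) => i ltid.
    have [ltik ltil] : (i < k)%N /\ (i < l)%N.
      by have := leq_trans ltid szd; rewrite leq_min => /andP[].
    have <- : (U *m M' *m V) (Ordinal ltik) (Ordinal ltil) = d`_i.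
      by rewrite eM' !mxE eqxx.
    rewrite mxE; apply: (big_ind (dvdp a)); [exact: dvdp0|exact: dvdp_add|] => i1 _.
    apply: dvdp_mulr; rewrite mxE.
    apply: (big_ind (dvdp a)); [exact: dvdp0|exact: dvdp_add|] => i2 _.
    exact/dvdp_mull/aM'.
  by case: d ad sd {szd md eM'} => //= b d /andP[-> _].
apply: (unimodular_eqv_trans eM).
exists (block_mx 1%:M 0 0 U), (block_mx 1%:M 0 0 V).
rewrite !unitmxE !det_ublock !det1 !mul1r -!unitmxE; split=> //.
rewrite !mulmx_block !mul0mx !mulmx0 !mul1mx !mulmx1 !addr0 !add0r mul0mx eM'.
apply/matrixP => i j; rewrite [RHS]mxE.
rewrite -(fintype.splitK i) -(fintype.splitK j).
case: (fintype.split i) => i'; case: (fintype.split j) => j' /=.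
- by rewrite block_mxEul !mxE !ord1.
- by rewrite block_mxEur !mxE !ord1.
- by rewrite block_mxEdl !mxE !ord1.
- by rewrite block_mxEdr !mxE /= !add1n eqSS.
Qed.

End Smith.

(** * Root multiplicities of the invariant polynomials *)

Section SmithCompare.
Variable F : fieldType.

Lemma mup_gt0 (p : {poly F}) s : p != 0 -> (0 < mup s p)%N = root p s.
Proof. by move=> p0; rewrite -XsubC_dvd // dvdp_XsubCl. Qed.

Lemma mup_exp_dvd (p : {poly F}) s : ('X - s%:P) ^+ mup s p %| p.
Proof.
by have [->|p0] := eqVneq p 0; [exact: dvdp0 | rewrite -mup_geq].
Qed.

Lemma root_mup_cofactor (p : {poly F}) s :
  p != 0 -> ~~ root (p %/ ('X - s%:P) ^+ mup s p) s.
Proof.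
move=> p0; set e := _ %/ _.
have pE : p = e * ('X - s%:P) ^+ mup s p by rewrite divpK // mup_exp_dvd.
have e0 : e != 0 by apply: contraNneq p0 => e0; rewrite pE e0 mul0r.
have X0 : ('X - s%:P) ^+ mup s p != 0 by rewrite expf_neq0 // polyXsubC_eq0.
rewrite -mup_gt0 // -eqn0Ngt -(eqn_add2r (mup s (('X - s%:P) ^+ mup s p))).
by rewrite -mupM // -pE mup_XsubCX eqxx.
Qed.

Lemma XsubC_exp_dvdp_Mr (p c : {poly F}) s n :
  ~~ root c s -> (('X - s%:P) ^+ n %| c * p) = (('X - s%:P) ^+ n %| p).
Proof.
by move=> cs; rewrite Gauss_dvdpr // coprimep_expl // coprimep_sym coprimep_XsubC.
Qed.

(** Isolates the square core, to which determinants apply; the rectangular [pid_mx] factors only pad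
    with zeros. *)
Lemma diag_seq_mxE r k l (d : seq {poly F}) : size d = r -> (r <= k)%N -> (r <= l)%N ->
  diag_seq_mx k l d = (pid_mx r : 'M[{poly F}]_(k, r)) *m
    diag_mx (\row_i d`_i) *m (pid_mx r : 'M[{poly F}]_(r, l)).
Proof.
move=> szd rk rl; apply/matrixP => i j; rewrite mul_mx_diag !mxE.
have [ltir|leri] := ltnP i r.
  rewrite (bigD1 (Ordinal ltir)) //= big1 => [|t /eqP ti].
    by rewrite !mxE /= eqxx ltir mul1r addr0; case: eqP; rewrite ?mulr1 ?mulr0.
  have /negbTE it : i != t :> nat by rewrite eq_sym; apply/eqP => it; apply/ti/val_inj.
  by rewrite !mxE it /= !mul0r.
by rewrite big1 => [|t _]; [rewrite nth_default ?szd // if_same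
  | rewrite !mxE ltnNge leri andbF !mul0r].
Qed.

Lemma mulmx_pid_id r q l (H : 'M[{poly F}]_(q, l)) :
  (forall i (j : 'I_l), (r <= j)%N -> H i j = 0) ->
  H *m (pid_mx r : 'M[{poly F}]_(l, r)) *m (pid_mx r : 'M[{poly F}]_(r, l)) = H.
Proof.
move=> H0; rewrite -mulmxA mul_pid_mx !minnn; apply/matrixP => i j.
rewrite mxE (bigD1 j) //= big1 => [|t tj]; last first.
  by rewrite mxE (negbTE (tj : t != j :> nat)) mulr0.
rewrite mxE eqxx addr0 /=; case: ltnP => [_|/H0->]; first by rewrite mulr1.
by rewrite mul0r.
Qed.

Lemma pid_mx_cancel r k (rk : (r <= k)%N) :
  (pid_mx r : 'M[{poly F}]_(r, k)) *m (pid_mx r : 'M[{poly F}]_(k, r)) = 1%:M :> 'M[{poly F}]_r.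
Proof. by rewrite pid_mx_id // pid_mx_1. Qed.

Lemma det_diag_seq r (d : seq {poly F}) : size d = r ->
  \det (diag_mx (\row_(i < r) d`_i)) = \prod_(a <- d) a.
Proof.
by move=> <-; rewrite det_diag (big_nth 0) big_mkord; apply: eq_bigr => i _; rewrite mxE.
Qed.

(* With r = size d, both sides factor through r columns. The r x r core D of diag d is
   W1 D' X for the core D' of diag d', and D' is a multiple of the column N of D and
   the first r columns of H, so determinants can be compared without minors. *)
Lemma smith_mup_compare k q l (d d' : seq {poly F}) (H : 'M[{poly F}]_(q, l)) s :
  size d = size d' -> (size d <= minn k l)%N -> 0 \notin d -> 0 \notin d' ->
  (forall i (j : 'I_l), (size d <= j)%N -> H i j = 0) ->
  unimodular_eqv (col_mx (diag_seq_mx k l d) H) (diag_seq_mx (k + q) l d') ->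
  mup s (\prod_(a <- d) a) = mup s (\prod_(a <- d') a) <->
  (forall i (j : 'I_l), ('X - s%:P) ^+ mup s d`_j %| H i j).
Proof.
set r := size d => szd'; rewrite leq_min => /andP[rk rl] d0 d'0 H0 [U [V [uU uV]]].
have rkq : (r <= k + q)%N by rewrite (leq_trans rk) ?leq_addr.
rewrite (diag_seq_mxE (erefl r)) // (diag_seq_mxE (esym szd')) //.
set D := diag_mx _; set D' := diag_mx _.
have detD : \det D = \prod_(a <- d) a by exact: det_diag_seq.
have detD' : \det D' = \prod_(a <- d') a by exact/det_diag_seq/esym.
have nz (e : seq {poly F}) : 0 \notin e -> \prod_(a <- e) a != 0.
  move=> e0; rewrite prodf_seq_neq0; apply/allP => a ae /=.
  by apply: contraNneq e0 => <-.
have D0 : \det D != 0 by rewrite detD nz.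
have D'0 : \det D' != 0 by rewrite detD' nz.
pose HJ : 'M[{poly F}]_(q, r) := H *m pid_mx r.
have HJE i (j : 'I_r) : HJ i j = H i (widen_ord rl j).
  rewrite mxE (bigD1 (widen_ord rl j)) //= big1 => [|t tj].
    by rewrite !mxE /= eqxx ltn_ord mulr1 addr0.
  by rewrite !mxE (negbTE (_ : t != j :> nat)) ?mulr0.
pose N := col_mx ((pid_mx r : 'M[{poly F}]_(k, r)) *m D) HJ.
have <- : N *m pid_mx r = col_mx (pid_mx r *m D *m pid_mx r) H.
  by rewrite mul_col_mx mulmx_pid_id.
clearbody HJ; move=> eN.
(* [X] and [Y] are the leading r x r corners of V^-1 and V. Truncating the equivalence expresses [N]
   through [D'] and [D'] through [N]. *)
pose X : 'M[{poly F}]_r := pid_mx r *m invmx V *m pid_mx r.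
pose Y : 'M[{poly F}]_r := pid_mx r *m V *m pid_mx r.
have NX : N = invmx U *m pid_mx r *m D' *m X.
  rewrite /X !mulmxA -2!(mulmxA (invmx U)) -eN.
  rewrite -!(mulmxA U) mulKmx // -!mulmxA mulKVmx // pid_mx_cancel //.
  by rewrite mulmx1.
have D'Y : D' = pid_mx r *m U *m N *m Y.
  rewrite /Y !mulmxA -4!(mulmxA (pid_mx r)) !mulmxA.
  have := congr1 (fun Z => (pid_mx r : 'M[{poly F}]_(r, k + q)) *m Z *m
    (pid_mx r : 'M[{poly F}]_(l, r))) eN.
  rewrite !mulmxA pid_mx_cancel // mul1mx -(mulmxA D') pid_mx_cancel // mulmx1.
  by move<-.
pose W := invmx U *m (pid_mx r : 'M[{poly F}]_(k + q, r)).
have [topN botN] : pid_mx r *m D = usubmx W *m D' *m X /\ HJ = dsubmx W *m D' *m X.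
  apply/eq_col_mx; rewrite -/N {1}NX -/W -{1}(vsubmxK W).
  by rewrite !mul_col_mx.
pose W1 : 'M[{poly F}]_r := pid_mx r *m usubmx W.
have DX : D = W1 *m D' *m X.
  by rewrite -(mul1mx D) -(pid_mx_cancel rk) -mulmxA topN !mulmxA.
clearbody W1 X Y.
have detDX : \det D = \det W1 * \det D' * \det X by rewrite DX !det_mulmx.
have [W10 X0] : \det W1 != 0 /\ \det X != 0.
  by move: D0; rewrite detDX !mulf_eq0 !negb_or => /andP[/andP[-> _] ->].
have mupD : mup s (\det D) = (mup s (\det W1) + mup s (\det D') + mup s (\det X))%N.
  by rewrite detDX !mupM ?mulf_neq0.
rewrite -detD -detD'; split=> [mupE i j | dvH].
  have [lerj|ltjr] := leqP r j; first by rewrite H0.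
  pose j' := Ordinal ltjr; have -> : H i j = HJ i j'.
    by rewrite HJE; congr (H _ _); apply: val_inj.
  (* Equal multiplicities leave none for [\det W1], so [W1] is invertible locally at [s]; its
     adjugate makes [\det W1 *: HJ] a left multiple of [D]. *)
  have W1s : ~~ root (\det W1) s.
    rewrite -mup_gt0 // -eqn0Ngt; apply/eqP; move: mupD; rewrite mupE; lia.
  rewrite -(XsubC_exp_dvdp_Mr _ _ W1s).
  have -> : \det W1 * HJ i j' = (dsubmx W *m \adj W1 *m D) i j'.
    rewrite [in RHS]DX !mulmxA -(mulmxA _ (\adj W1)) mul_adj_mx.
    by rewrite mul_mx_scalar -!scalemxAl mxE -botN.
  by rewrite mul_mx_diag !mxE dvdp_mull // mup_exp_dvd.
(* Conversely, [c] collects the cofactors prime to X - s. Up to this local unit, [HJ] and then [D']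
   factor through [D], so determinants bound the multiplicity of [\det D] by that of [\det D'];
   [mupD] gives the other inequality. *)
pose e (j : 'I_r) := d`_j %/ ('X - s%:P) ^+ mup s d`_j.
pose c := \prod_j e j.
have dn0 (j : 'I_r) : d`_j != 0.
  by apply: contraNneq d0 => <-; rewrite mem_nth.
have cs : ~~ root c s.
  by rewrite /root horner_prod; apply/prodf_neq0 => j _; apply: root_mup_cofactor.
pose Q := \matrix_(i < q, j < r)
  (\prod_(t | t != j) e t * (HJ i j %/ ('X - s%:P) ^+ mup s d`_j)).
have cHJ : c *: HJ = Q *m D.
  apply/matrixP => i j; rewrite mul_mx_diag !mxE.
  have eHJ : e j * HJ i j = HJ i j %/ ('X - s%:P) ^+ mup s d`_j * d`_j.
    rewrite -{2}(divpK (mup_exp_dvd d`_j s)) -/(e j) mulrCA.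
    by rewrite divpK // HJE; exact: (dvH i (widen_ord rl j)).
  by rewrite /c (bigD1 j) //= mulrAC eHJ mulrC mulrA.
have cD' : c *: D' = pid_mx r *m U *m col_mx (c *: pid_mx r) Q *m D *m Y.
  rewrite {1}D'Y scalemxAl; congr (_ *m _); rewrite scalemxAr -[RHS]mulmxA; congr (_ *m _).
  by rewrite mul_col_mx -cHJ scale_col_mx scalemxAl.
move: (congr1 determinant cD'); rewrite detZ !det_mulmx => detcD'.
have : (mup s (\det D) <= mup s (\det D'))%N.
  rewrite -(mupMr (\det D') (_ : ~~ root (c ^+ r) s)); last by rewrite /root horner_exp expf_neq0.
  have c0 : c != 0 by apply: contraNneq cs => ->; rewrite root0.
  rewrite mup_geq ?mulf_neq0 ?expf_neq0 // detcD' dvdp_mulr // dvdp_mull //.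
  exact: mup_exp_dvd.
lia.
Qed.
End SmithCompare.

(** * Polynomials acting on sequences of derivatives *)

(* K^nat with 'X acting as the shift: on the sequence of the derivatives of a function
   at a given time, p acts as p(d/dt). *)
Definition seqmod (K : comNzRingType) : Type := nat -> K.
HB.instance Definition _ (K : comNzRingType) :=
  GRing.Zmodule.copy (seqmod K) (nat -> K).

Section SeqMod.
Variable K : comNzRingType.
Implicit Types (p q : {poly K}) (a b : seqmod K).

Lemma seqmodDE a b j : (a + b) j = a j + b j. Proof. by []. Qed.

Definition seq_scale p a : seqmod K := fun j => \sum_(i < size p) p`_i * a (i + j)%N.

Lemma seq_scale_widen n p a j : (size p <= n)%N ->
  seq_scale p a j = \sum_(i < n) p`_i * a (i + j)%N.
Proof.
move=> szp; rewrite /seq_scale (big_ord_widen n (fun i => p`_i * a (i + j)%N)) //.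
rewrite big_mkcond; apply: eq_bigr => i _; case: ltnP => // szi.
by rewrite nth_default // mul0r.
Qed.

Lemma seq_scaleDl a p q : seq_scale (p + q) a = seq_scale p a + seq_scale q a.
Proof.
apply/funext => j; rewrite seqmodDE.
pose n := maxn (size p) (size q).
rewrite (@seq_scale_widen n (p + q)) ?size_polyD //.
rewrite (@seq_scale_widen n p) ?leq_maxl // (@seq_scale_widen n q) ?leq_maxr //.
by rewrite -big_split; apply: eq_bigr => i _; rewrite coefD mulrDl.
Qed.

Lemma seq_scaleDr p a b : seq_scale p (a + b) = seq_scale p a + seq_scale p b.
Proof.
apply/funext => j; rewrite seqmodDE -big_split.
by apply: eq_bigr => i _; rewrite mulrDr.
Qed.

Lemma seq_scaleMX p a : seq_scale (p * 'X) a = seq_scale p (fun j => a j.+1).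
Proof.
apply/funext => j; rewrite (@seq_scale_widen (size p).+1); last first.
  by rewrite (leq_trans (size_polyMleq _ _)) // size_polyX addn2.
rewrite big_ord_recl coefMX mul0r add0r; apply: eq_bigr => i _.
by rewrite coefMX /= /bump /= add1n addSn.
Qed.

Lemma seq_scaleC c a : seq_scale c%:P a = fun j => c * a j.
Proof.
apply/funext => j; rewrite (@seq_scale_widen 1) ?size_polyC_leq1 //.
by rewrite big_ord1 coefC.
Qed.

Lemma seq_scaleA p q a : seq_scale p (seq_scale q a) = seq_scale (p * q) a.
Proof.
elim/poly_ind: p q a => [|p c IHp] q a.
  by rewrite mul0r; apply/funext => j; rewrite /seq_scale size_poly0 !big_ord0.
rewrite mulrDl !seq_scaleDl seq_scaleMX -mulrA -IHp -commr_polyX seq_scaleMX.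
rewrite seq_scaleC; congr (_ + _).
  congr (seq_scale p _); apply/funext => j.
  by apply: eq_bigr => i _; rewrite addnS.
apply/funext => j; rewrite [RHS](@seq_scale_widen (size q)).
  by rewrite /seq_scale mulr_sumr; apply: eq_bigr => i _; rewrite coefCM mulrA.
by rewrite mul_polyC size_scale_leq.
Qed.

Lemma seq_scale1 : left_id 1 seq_scale.
Proof. by move=> a; rewrite seq_scaleC; apply/funext => j; rewrite mul1r. Qed.

End SeqMod.

HB.instance Definition _ (K : comNzRingType) :=
  GRing.Zmodule_isLmodule.Build {poly K} (seqmod K)
    (@seq_scaleA K) (@seq_scale1 K) (@seq_scaleDr K) (@seq_scaleDl K).

Section SeqModTheory.
Variable K : comNzRingType.
Implicit Types (p q : {poly K}) (a b : seqmod K).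

Lemma seqmodZE p a j : (p *: a) j = \sum_(i < size p) p`_i * a (i + j)%N.
Proof. by []. Qed.

Lemma seqmodXE a j : ('X *: a) j = a j.+1.
Proof. by rewrite -['X]mul1r [LHS](congr1 (@^~ j) (seq_scaleMX 1 a)) seq_scale1. Qed.

Lemma seqmodCE c a j : (c%:P *: a) j = c * a j.
Proof. exact: (congr1 (@^~ j) (seq_scaleC c a)). Qed.

Lemma seqmodNE a j : (- a) j = - a j. Proof. by []. Qed.

Lemma seqmod_sumE I (r : seq I) (P : pred I) (f : I -> seqmod K) j :
  (\sum_(i <- r | P i) f i) j = \sum_(i <- r | P i) f i j.
Proof. by elim/big_rec2: _ => // i x y _ <-. Qed.

(** Q(d/dt) applied to a vector of derivative sequences. The vector is a family over indices because
    its entries lie in a module over [{poly K}], where [*m] does not apply. *)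
Definition mx_act k l (Q : 'M[{poly K}]_(k, l)) (w : 'I_l -> seqmod K) (i : 'I_k) : seqmod K :=
  \sum_j Q i j *: w j.

Lemma mx_actM k l n (Q : 'M[{poly K}]_(k, l)) (Q' : 'M[{poly K}]_(l, n)) w :
  mx_act (Q *m Q') w = mx_act Q (mx_act Q' w).
Proof.
apply/funext => i; rewrite /mx_act.
under eq_bigr do rewrite mxE scaler_suml.
rewrite exchange_big /=; apply: eq_bigr => j _; rewrite scaler_sumr.
by apply: eq_bigr => t _; rewrite scalerA.
Qed.

Lemma mx_act_cst0 k l (Q : 'M[{poly K}]_(k, l)) w : (forall i, w i = 0) -> forall i, mx_act Q w i = 0.
Proof. by move=> w0 i; rewrite /mx_act big1 // => j _; rewrite w0 scaler0. Qed.

End SeqModTheory.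

(** * Jets of real and complex functions of time *)

Section Jets.
Variable R : realType.
Local Notation C := R[i].
Implicit Types (D : set R) (w : R -> seqmod R).

(** [w t] lists a function and all its derivatives at [t]. The set [D] is the open half-line for
    given trajectories and the whole line for constructed modes. *)
Definition is_jet D w := forall t, D t -> forall j,
  is_derive t (1 : R) (fun t => w t j) (w t j.+1).

Lemma is_jetZ D p w : is_jet D w -> is_jet D (fun t => p *: w t).
Proof.
move=> jw t Dt j.
rewrite (_ : (fun t => _) = \sum_(i < size p) (fun t => p`_i * w t (i + j)%N)); last first.
  by apply/funext => u; rewrite seqmodZE fct_sumE.
rewrite seqmodZE; apply: is_derive_sum => i.
have := jw t Dt (i + j)%N; rewrite -addnS => h.
exact: is_deriveZ.
Qed.

Lemma is_jetD D w1 w2 : is_jet D w1 -> is_jet D w2 -> is_jet D (fun t => w1 t + w2 t).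
Proof. by move=> j1 j2 t Dt j; apply: is_deriveD; [exact: j1|exact: j2]. Qed.

Lemma is_jet_sum D I (r : seq I) (w : I -> R -> seqmod R) :
  (forall i, is_jet D (w i)) -> is_jet D (fun t => \sum_(i <- r) w i t).
Proof.
move=> jw; elim: r => [|i r IHr] t Dt j.
  rewrite big_nil [X in is_derive _ _ X _](_ : _ = cst 0); first exact: is_derive_cst.
  by apply/funext => u; rewrite big_nil.
under eq_fun do rewrite big_cons; rewrite big_cons.
exact: (is_jetD (jw i) IHr).
Qed.

Definition seq_re (a : seqmod C) : seqmod R := fun j => complex.Re (a j).
Definition seq_im (a : seqmod C) : seqmod R := fun j => complex.Im (a j).
Definition seq_complex (a : seqmod R) : seqmod C := fun j => (a j)%:C.

Definition is_cjet D (w : R -> seqmod C) :=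
  is_jet D (fun t => seq_re (w t)) /\ is_jet D (fun t => seq_im (w t)).

Lemma seq_reZ p a :
  seq_re (p *: a) = map_poly (@complex.Re R) p *: seq_re a
                    - map_poly (@complex.Im R) p *: seq_im a.
Proof.
apply/funext => j; rewrite seqmodDE seqmodNE.
rewrite /seq_re seqmodZE raddf_sum /=.
rewrite [X in _ = X - _](@seq_scale_widen _ (size p)) ?size_poly //.
rewrite [X in _ = _ - X](@seq_scale_widen _ (size p)) ?size_poly //.
rewrite -sumrB; apply: eq_bigr => i _; rewrite !coef_map /seq_re /seq_im /=.
by case: (p`_i) => x y; case: (a _) => u v.
Qed.

Lemma seq_imZ p a :
  seq_im (p *: a) = map_poly (@complex.Re R) p *: seq_im a
                    + map_poly (@complex.Im R) p *: seq_re a.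
Proof.
apply/funext => j; rewrite seqmodDE.
rewrite /seq_im seqmodZE raddf_sum /=.
rewrite [X in _ = X + _](@seq_scale_widen _ (size p)) ?size_poly //.
rewrite [X in _ = _ + X](@seq_scale_widen _ (size p)) ?size_poly //.
rewrite -big_split; apply: eq_bigr => i _; rewrite !coef_map /seq_re /seq_im /=.
by case: (p`_i) => x y; case: (a _) => u v.
Qed.

Lemma is_cjetZ D p (w : R -> seqmod C) : is_cjet D w -> is_cjet D (fun t => p *: w t).
Proof.
move=> [jr ji]; split.
  under eq_fun do rewrite seq_reZ -scaleNr.
  by apply: is_jetD; apply: is_jetZ.
under eq_fun do rewrite seq_imZ.
by apply: is_jetD; apply: is_jetZ.
Qed.

Local Notation toC := (map_poly (real_complex R)).

(** Real operators commute with real parts, so the real part of a complex solution solves the same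
    real equation. *)
Lemma seq_re_real p a : seq_re (toC p *: a) = p *: seq_re a.
Proof.
rewrite seq_reZ -!map_poly_comp /=.
rewrite (@eq_map_poly _ _ (_ \o _) id) // map_poly_id //.
rewrite [map_poly _ p](_ : _ = 0) ?scale0r ?subr0 //.
by apply/polyP => i; rewrite coef_map_id0 ?coef0.
Qed.

Lemma seq_im_real p a : seq_im (toC p *: a) = p *: seq_im a.
Proof.
rewrite seq_imZ -!map_poly_comp /=.
rewrite (@eq_map_poly _ _ (_ \o _) id) // map_poly_id //.
rewrite [map_poly _ p](_ : _ = 0) ?scale0r ?addr0 //.
by apply/polyP => i; rewrite coef_map_id0 ?coef0.
Qed.

Lemma seq_complexZ p a : seq_complex (p *: a) = toC p *: seq_complex a.
Proof.
apply/funext => j; rewrite seqmodZE /seq_complex seqmodZE.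
rewrite size_map_poly rmorph_sum; apply: eq_bigr => i _.
by rewrite coef_map /= rmorphM.
Qed.

End Jets.

(** * Decaying and persistent modes *)

Section Stability.
Variable R : realType.
Implicit Types (a b g k : R -> R).

Lemma is_derive_scale (c t : R) : is_derive t (1 : R) (fun t : R => c * t) c.
Proof.
have := is_deriveZ c (is_derive_id t (1 : R)).
by rewrite /GRing.scale /= mulr1.
Qed.

(* For e > 0, e^(-alpha t) (phi t - e / 2) is eventually nonincreasing. *)
Lemma derive_le_decay (alpha : R) (phi dphi psi : R -> R) : alpha < 0 ->
  (forall t : R, 0 < t -> is_derive t (1 : R) phi (dphi t)) ->
  (forall t : R, 0 < t -> dphi t <= alpha * phi t + psi t) ->
  psi t @[t --> +oo] --> (0 : R) ->
  forall e : R, 0 < e -> \forall t \near +oo, phi t < e.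
Proof.
move=> a0 dphiP phi_le psi0 e e0; pose e' := e / 2.
have e'0 : 0 < e' by rewrite divr_gt0.
have ae0 : 0 < - alpha * e' by rewrite mulr_gt0 // oppr_gt0.
have [T [_ psiT]] : \forall t \near +oo, `|0 - psi t| < - alpha * e'.
  by move/cvgrPdist_lt: psi0; apply.
pose T1 : R := Num.max (T + 1) 1.
have T10 : 0 < T1 by rewrite lt_max ltr01 orbT.
have psiT1 (t : R) : T1 <= t -> psi t <= - alpha * e'.
  move=> T1t; apply: le_trans (ler_norm _) _.
  rewrite -normrN -sub0r; apply/ltW/psiT.
  by rewrite (lt_le_trans _ T1t) // lt_max ltrDl ltr01.
pose u (t : R) : R := expR (- alpha * t) * (phi t - e').
have du (t : R) : 0 < t -> is_derive t (1 : R) u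
    (expR (- alpha * t) * (dphi t - alpha * (phi t - e'))).
  move=> t0; have d1 := dphiP t t0.
  have d3 := @is_derive1_comp _ expR _ t _ _ (is_derive_expR (- alpha * t))
    (is_derive_scale (- alpha) t).
  have d4 := is_deriveM d3 (is_deriveB d1 (is_derive_cst e' t (1 : R))).
  apply: is_derive_eq d4 _ .
  rewrite /GRing.scale /= !fctE /=; ring.
have u_le (t : R) : T1 <= t -> u t <= u T1.
  move=> T1t; apply: (@ler0_derive1_nincry _ u T1) => // [x|x|].
  - by rewrite in_itv /= andbT => T1x; have [] := du x (lt_trans T10 T1x).
  - rewrite in_itv /= andbT => T1x; have x0 := lt_trans T10 T1x.
    have := du x x0 => dux; rewrite derive1E derive_val.
    rewrite pmulr_rle0 ?expR_gt0 //.
    have := phi_le x x0; have := psiT1 x (ltW T1x); lra.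
  - apply: continuous_in_subspaceT => x; rewrite inE /= in_itv /= andbT => T1x.
    have [dx _] := du x (lt_le_trans T10 T1x).
    exact/differentiable_continuous/derivable1_diffP.
(* Past [X] the term e^(alpha t) u(T1) is below e / 2; the [+ 1] keeps the denominator positive. *)
have [X [_ expX]] : \forall x \near +oo, `|0 - expR (- x)| < e' / (`|u T1| + 1).
  move/cvgrPdist_lt: (@cvgr_expR R); apply; rewrite divr_gt0 //.
near=> t.
have T1t : T1 <= t by near: t; apply: nbhs_pinfty_ge; exact: num_real.
have : X < - alpha * t.
  rewrite mulrC -ltr_pdivrMr ?oppr_gt0 //.
  by near: t; apply: nbhs_pinfty_gt; exact: num_real.
move=> /expX; rewrite sub0r normrN ger0_norm ?expR_ge0 // => small.
have := u_le t T1t; rewrite /u -/(u T1).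
have Egt : 0 < expR (- alpha * t) by exact: expR_gt0.
rewrite mulrC -ler_pdivlMr // -expRN.
move: small; rewrite ltr_pdivlMr ?ltr_wpDl // => small h.
have : u T1 * expR (- (- alpha * t)) < e'.
  apply: le_lt_trans small; rewrite mulrC ler_wpM2l ?expR_ge0 //.
  by rewrite (le_trans (ler_norm _)) // lerDl.
by rewrite /e' in h *; lra.
Unshelve. all: by end_near.
Qed.

(** Real form of w' = (alpha + i beta) w + (g + i k). In the derivative of |w|^2 the terms in beta
    cancel, leaving 2 alpha |w|^2 plus cross terms with the vanishing forcing. *)
Lemma linear_ode_stable (alpha beta : R) a b g k : alpha < 0 ->
  (forall t : R, 0 < t -> is_derive t (1 : R) a (alpha * a t - beta * b t + g t)) ->
  (forall t : R, 0 < t -> is_derive t (1 : R) b (alpha * b t + beta * a t + k t)) ->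
  g t @[t --> +oo] --> (0 : R) -> k t @[t --> +oo] --> (0 : R) ->
  a t @[t --> +oo] --> (0 : R) /\ b t @[t --> +oo] --> (0 : R).
Proof.
move=> a0 da db g0 k0; pose phi (t : R) : R := a t * a t + b t * b t.
pose dphi (t : R) : R := 2 * (alpha * phi t + a t * g t + b t * k t).
have phi0 : forall e : R, 0 < e -> \forall t \near +oo, phi t < e.
  apply: (@derive_le_decay alpha _ dphi
           (fun t => (g t * g t + k t * k t) * (- alpha)^-1)) => // [t t0|t t0|].
  - have dat := da t t0; have dbt := db t t0.
    apply: is_derive_eq (is_deriveD (is_deriveM dat dat) (is_deriveM dbt dbt)) _.
    by rewrite /GRing.scale /= /dphi /phi; ring.
    (* AM-GM absorbs the cross terms into half of the damping. *)
  - have AMGM (x y : R) : 2 * (x * y) <= - alpha * (x * x) + y * y * (- alpha)^-1.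
      rewrite -subr_ge0.
      have -> : - alpha * (x * x) + y * y * (- alpha)^-1 - 2 * (x * y) =
         (- alpha * x - y) ^+ 2 * (- alpha)^-1 by field; rewrite ?lt_eqF.
      by rewrite mulr_ge0 ?sqr_ge0 // invr_ge0 oppr_ge0 ltW.
    have := AMGM (a t) (g t); have := AMGM (b t) (k t); rewrite /dphi /phi; lra.
  - rewrite (_ : 0 = (0 * 0 + 0 * 0) * (- alpha)^-1 :> R); last by rewrite !mul0r addr0 mul0r.
    by apply: cvgM; [apply: cvgD; apply: cvgM | exact: cvg_cst].
have sq (c d : R) e : 0 < e -> c * c + d * d < e * e -> `|c| < e.
  move=> e0 cde; rewrite ltNge; apply/negP => ec.
  have := ler_pM (ltW e0) (ltW e0) ec ec.
  rewrite -normrM ger0_norm; last by rewrite -expr2 sqr_ge0.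
  have := sqr_ge0 d; rewrite expr2; lra.
by split; apply/cvgrPdist_lt => e e0; near=> t; rewrite sub0r normrN;
  [apply: (sq _ (b t)) | apply: (sq _ (a t)) => //; rewrite addrC] => //;
  near: t; apply: phi0; rewrite mulr_gt0.
Unshelve. all: by end_near.
Qed.

End Stability.

Lemma prod_XsubC_dvdp (F : fieldType) (rs : seq F) (h : {poly F}) : h != 0 ->
  (forall s, (count_mem s rs <= mup s h)%N) -> \prod_(z <- rs) ('X - z%:P) %| h.
Proof.
elim: rs h => [|z rs IHrs] h h0 cnt; first by rewrite big_nil dvd1p.
have Xz0 : 'X - z%:P != 0 :> {poly F} by rewrite polyXsubC_eq0.
have /dvdpP[h' hE] : 'X - z%:P %| h.
  rewrite dvdp_XsubCl -mup_gt0 // (leq_trans _ (cnt z)) //=.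
  by rewrite eqxx.
have h'0 : h' != 0 by apply: contraNneq h0 => h'0; rewrite hE h'0 mul0r.
rewrite big_cons hE mulrC dvdp_mul2r // IHrs // => s.
have := cnt s; rewrite hE mupM // -['X - z%:P]expr1 mup_XsubCX /=.
by case: eqP => _; rewrite ?addn0 ?add0n // add1n addn1 ltnS.
Qed.

(** * Decay of jets annihilated by a stable polynomial *)

Section JetStability.
Variable R : realType.
Local Notation C := R[i].
Local Notation toC := (map_poly (real_complex R)).

(** All derivatives have to vanish, which makes the property stable under the action of
    polynomials. *)
Definition vanishes_at_pinfty (w : R -> seqmod R) :=
  forall j, w t j @[t --> +oo] --> (0 : R).

Lemma vanishesZ p w : vanishes_at_pinfty w -> vanishes_at_pinfty (fun t => p *: w t).
Proof.
move=> w0 j; under eq_fun do rewrite seqmodZE.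
have : \sum_(i < size p) p`_i * w t (i + j)%N @[t --> +oo] --> \sum_(i < size p) p`_i * 0.
  apply: cvg_big => [|i _]; first exact: add_continuous.
  by apply: cvgM; [exact: cvg_cst | exact: w0].
by rewrite big1 // => i _; rewrite mulr0.
Qed.

Lemma vanishesD w1 w2 : vanishes_at_pinfty w1 -> vanishes_at_pinfty w2 ->
  vanishes_at_pinfty (fun t => w1 t + w2 t).
Proof. by move=> h1 h2 j; rewrite -(addr0 0); apply: cvgD; [exact: h1|exact: h2]. Qed.

Definition cvanishes_at_pinfty (w : R -> seqmod C) :=
  vanishes_at_pinfty (fun t => seq_re (w t)) /\ vanishes_at_pinfty (fun t => seq_im (w t)).

Lemma cvanishesZ p w : cvanishes_at_pinfty w -> cvanishes_at_pinfty (fun t => p *: w t).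
Proof.
move=> [hr hi]; split.
  under eq_fun do rewrite seq_reZ -scaleNr.
  by apply: vanishesD; apply: vanishesZ.
under eq_fun do rewrite seq_imZ.
by apply: vanishesD; apply: vanishesZ.
Qed.

(** Roots are removed one at a time: v = (X - z) w decays by induction, and w' = z w + v is a
    first-order equation with Re z < 0 and vanishing forcing, at every order of differentiation. *)
Lemma stable_cjet (rs : seq C) (w : R -> seqmod C) :
  is_cjet [set t | 0 < t] w -> {in rs, forall z, complex.Re z < 0} ->
  (forall t, 0 < t -> (\prod_(z <- rs) ('X - z%:P)) *: w t = 0) ->
  cvanishes_at_pinfty w.
Proof.
elim: rs w => [|z rs IHrs] w jw rs0 w0.
  by split=> j; apply: (@cvg_near_cst R R); near=> t;
    rewrite -[w t]scale1r; have := w0 t; rewrite big_nil => ->.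
have [vr vi] : cvanishes_at_pinfty (fun t => ('X - z%:P) *: w t).
  apply: IHrs => [|y yrs|t t0]; first exact: is_cjetZ.
    by apply: rs0; rewrite in_cons yrs orbT.
  by have := w0 t t0; rewrite big_cons mulrC -scalerA.
have wS t j : w t j.+1 = z * w t j + (('X - z%:P) *: w t) j.
  by rewrite scalerBl seqmodDE seqmodNE seqmodXE seqmodCE addrC subrK.
have z0 : complex.Re z < 0 by apply: rs0; rewrite mem_head.
have [jr ji] := jw.
suff h j : (complex.Re (w t j) @[t --> +oo] --> (0 : R)) /\
           (complex.Im (w t j) @[t --> +oo] --> (0 : R)).
  by split=> j; have [] := h j.
apply: (@linear_ode_stable R (complex.Re z) (complex.Im z) _ _
  (fun t => seq_re (('X - z%:P) *: w t) j) (fun t => seq_im (('X - z%:P) *: w t) j)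
  z0 _ _ (vr j) (vi j)) => t t0.
  have dr := jr t t0 j. apply: (is_derive_eq dr); rewrite /seq_re wS.
  by move: (_ *: w t) => v; case: (z) (w t j) (v j) => x y [x' y'] [x'' y''].
have di := ji t t0 j; apply: (is_derive_eq di); rewrite /seq_im wS.
by move: (_ *: w t) => v; case: (z) (w t j) (v j) => x y [x' y'] [x'' y''].
Unshelve. all: by end_near.
Qed.

(* The factor of d with the roots in Re s >= 0 divides h, so h *: w is a multiple of a
   solution for the remaining factor, whose roots are stable. *)
Lemma stable_quotient (d h : {poly R}) (w : R -> seqmod R) : d != 0 ->
  (forall s : C, 0 <= complex.Re s -> ('X - s%:P) ^+ mup s (toC d) %| toC h) ->
  is_jet [set t | 0 < t] w -> (forall t, 0 < t -> d *: w t = 0) ->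
  (h *: w t) 0%N @[t --> +oo] --> (0 : R).
Proof.
move=> d0 dvdh jw dw0.
have [-> | h0] := eqVneq h 0.
  by under eq_fun do rewrite scale0r; exact: cvg_cst.
have dC0 : toC d != 0 by rewrite map_poly_eq0.
have hC0 : toC h != 0 by rewrite map_poly_eq0.
have [rs] := closed_field_poly_normal (toC d); set lc := lead_coef _ => dE.
have lc0 : lc != 0 by rewrite lead_coef_eq0.
pose unst (z : C) := 0 <= complex.Re z.
(* A root with negative real part does not occur in the filtered list; for the others the hypothesis
   bounds the count. *)
have /dvdpP[k hE] : \prod_(z <- [seq z <- rs | unst z]) ('X - z%:P) %| toC h.
  apply: prod_XsubC_dvdp => // s.
  have [us|nus] := boolP (unst s).
    apply: leq_trans (_ : (mup s (toC d) <= _)%N); last by rewrite mup_geq // dvdh.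
    rewrite dE -mul_polyC mupMr ?rootC ?lc0 // mu_prod_XsubC.
    by rewrite count_filter; apply: sub_count => z /andP[].
  rewrite (_ : count _ _ = 0)%N //; apply/eqP; rewrite -leqn0 leqNgt -has_count.
  by apply/hasPn => z; rewrite mem_filter => /andP[uz _]; apply: contraNneq nus => <-.
pose v t := (\prod_(z <- [seq z <- rs | unst z]) ('X - z%:P)) *: seq_complex (w t).
have jv : is_cjet [set t | 0 < t] v.
  apply: is_cjetZ; split; first exact: jw.
  by move=> t t0 j; exact: is_derive_cst.
have vv : cvanishes_at_pinfty v.
  apply: (@stable_cjet [seq z <- rs | ~~ unst z]) => // [z|t t0].
    by rewrite mem_filter -real_ltNge ?num_real // => /andP[].
  have cE : \prod_(z <- rs) ('X - z%:P) = lc^-1%:P * toC d.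
    by rewrite [in RHS]dE mul_polyC scalerA mulVf // scale1r.
  rewrite scalerA mulrC !big_filter.
  rewrite (_ : _ * _ = \prod_(z <- rs) ('X - z%:P)); last by rewrite [RHS](bigID unst).
  rewrite cE.
  by rewrite -scalerA -seq_complexZ dw0 // [seq_complex 0](_ : _ = 0) ?scaler0.
have [vr _] := cvanishesZ k vv.
have := vr 0%N; rewrite /v; under eq_fun do rewrite scalerA -hE /seq_re -seq_complexZ.
exact.
Qed.

End JetStability.

(** * Modes of the form polynomial times exponential *)

Section ExpJets.
Variable R : realType.
Local Notation C := R[i].
Local Notation toC := (map_poly (real_complex R)).

Lemma horner_real_complex (g : {poly C}) (t : R) :
  g.[t%:C] = (map_poly (@complex.Re R) g).[t] +i* (map_poly (@complex.Im R) g).[t].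
Proof.
rewrite horner_coef !(@horner_coef_wide _ (size g)) ?size_poly //.
apply/eqP; rewrite eq_complex /= !raddf_sum; apply/andP; split; apply/eqP;
  apply: eq_bigr => i _; rewrite coef_map /= -rmorphXn;
  by case: (g`_i) => x y /=; rewrite ?mulr0 ?subr0 ?add0r.
Qed.

Lemma deriv_map_additive (f : {additive C -> R}) (g : {poly C}) :
  map_poly f g^`() = (map_poly f g)^`().
Proof. by apply/polyP => i; rewrite coef_map !coef_deriv coef_map raddfMn. Qed.

Variable s : C.
Let alpha := complex.Re s.
Let beta := complex.Im s.

(** e^(s t), by Euler's formula. *)
Definition cexp (t : R) : C :=
  (expR (alpha * t) * cos (beta * t)) +i* (expR (alpha * t) * sin (beta * t)).

Lemma is_derive_expcos (t : R) : is_derive t (1 : R)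
  (fun t => expR (alpha * t) * cos (beta * t))
  (alpha * (expR (alpha * t) * cos (beta * t)) - beta * (expR (alpha * t) * sin (beta * t))).
Proof.
have de := @is_derive1_comp _ expR _ t _ _ (is_derive_expR (alpha * t))
  (is_derive_scale alpha t).
have dc := @is_derive1_comp _ (@cos R) _ t _ _ (is_derive_cos (beta * t))
  (is_derive_scale beta t).
apply: is_derive_eq (is_deriveM de dc) _.
by rewrite /GRing.scale /=; ring.
Qed.

Lemma is_derive_expsin (t : R) : is_derive t (1 : R)
  (fun t => expR (alpha * t) * sin (beta * t))
  (alpha * (expR (alpha * t) * sin (beta * t)) + beta * (expR (alpha * t) * cos (beta * t))).
Proof.
have de := @is_derive1_comp _ expR _ t _ _ (is_derive_expR (alpha * t))
  (is_derive_scale alpha t).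
have dc := @is_derive1_comp _ (@sin R) _ t _ _ (is_derive_sin (beta * t))
  (is_derive_scale beta t).
apply: is_derive_eq (is_deriveM de dc) _.
by rewrite /GRing.scale /=; ring.
Qed.

(* [expjet g t] is the sequence of derivatives at [t] of [g(t) e^(s t)]. *)
Definition expjet (g : {poly C}) (t : R) : seqmod C :=
  fun j => (iter j (fun g => g^`() + s *: g) g).[t%:C] * cexp t.

Lemma is_cjet_expjet g : is_cjet setT (expjet g).
Proof.
suff h (f : {poly C}) (t : R) :
    is_derive t (1 : R) (fun t : R => complex.Re (f.[t%:C] * cexp t))
      (complex.Re ((f^`() + s *: f).[t%:C] * cexp t)) /\
    is_derive t (1 : R) (fun t : R => complex.Im (f.[t%:C] * cexp t))
      (complex.Im ((f^`() + s *: f).[t%:C] * cexp t)).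
  by split=> t _ j; have [] := h (iter j (fun g => g^`() + s *: g) g) t.
rewrite hornerD hornerZ.
under eq_fun do rewrite horner_real_complex.
under [X in _ /\ is_derive _ _ X _]eq_fun do rewrite horner_real_complex.
rewrite !horner_real_complex !deriv_map_additive.
have dr := is_derive_poly (map_poly (@complex.Re R) f) t.
have di := is_derive_poly (map_poly (@complex.Im R) f) t.
have dc := is_derive_expcos t; have ds := is_derive_expsin t.
rewrite /cexp /=; split.
  apply: is_derive_eq (is_deriveB (is_deriveM dr dc) (is_deriveM di ds)) _.
  by rewrite /GRing.scale /= /alpha /beta; case: (s) => x y /=; ring.
apply: is_derive_eq (is_deriveD (is_deriveM dr ds) (is_deriveM di dc)) _.
by rewrite /GRing.scale /= /alpha /beta; case: (s) => x y /=; ring.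
Qed.

Lemma expjet0 t : expjet 0 t = 0.
Proof.
apply/funext => j; rewrite /expjet.
suff -> : iter j (fun g => g^`() + s *: g) 0 = 0 by rewrite horner0 mul0r.
by elim: j => //= j ->; rewrite deriv0 scaler0 addr0.
Qed.

(** (g e^(s t))' = (g' + s g) e^(s t), so X - s acts on the mode by differentiating its polynomial
    factor. *)
Lemma scale_XsubC_expjet g t : ('X - s%:P) *: expjet g t = expjet g^`() t.
Proof.
apply/funext => j; rewrite scalerBl seqmodDE seqmodNE seqmodXE seqmodCE /expjet /=.
rewrite hornerD hornerZ mulrDl mulrA addrK.
suff -> : (iter j (fun g => g^`() + s *: g) g)^`() = iter j (fun g => g^`() + s *: g) g^`() by [].
by elim: j => //= j IHj; rewrite derivD derivZ IHj.
Qed.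

Lemma scale_XsubC_exp_expjet n g t : ('X - s%:P) ^+ n *: expjet g t = expjet g^`(n) t.
Proof.
elim: n g => [|n IHn] g; first by rewrite expr0 scale1r derivn0.
by rewrite exprSr -scalerA scale_XsubC_expjet IHn -derivSn.
Qed.

(* The witness is t^k e^(st), k being the multiplicity of s in h: (X - s)^k maps it to
   k! e^(st) and (X - s)^(k+1) annihilates it. *)
Lemma unstable_quotient (d h : {poly R}) : 0 <= alpha -> h != 0 ->
  ('X - s%:P) ^+ (mup s (toC h)).+1 %| toC d ->
  ~ (forall w, is_jet setT w -> (forall t, d *: w t = 0) ->
       (h *: w t) 0%N @[t --> +oo] --> (0 : R)).
Proof.
move=> alpha0 h0 /dvdpP[q dE] conv; set k := mup s (toC h) in dE.
have hC0 : toC h != 0 by rewrite map_poly_eq0.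
pose W := expjet ('X^k).
have dW t : toC d *: W t = 0.
  rewrite dE -scalerA scale_XsubC_exp_expjet derivn_poly0 ?size_polyXn //.
  by rewrite expjet0 scaler0.
pose h1 := toC h %/ ('X - s%:P) ^+ k.
have h1s : h1.[s] != 0 by have := root_mup_cofactor s hC0; rewrite /root.
pose gamma := h1.[s] * (k`!)%:R.
have hW t : (toC h *: W t) 0%N = gamma * cexp t.
  rewrite -(divpK (mup_exp_dvd (toC h) s)) -/h1 -scalerA scale_XsubC_exp_expjet.
  rewrite derivnXn subnn expr0 ffactnn.
  (* Modulo X - s, which annihilates e^(s t), the cofactor [h1] acts as the constant h1(s). *)
  have /dvdpP[h2 h1E] : 'X - s%:P %| h1 - (h1.[s])%:P.
    by rewrite dvdp_XsubCl /root !hornerE subrr.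
  have -> : h1 = h2 * ('X - s%:P) + (h1.[s])%:P by rewrite -h1E subrK.
  rewrite scalerDl -scalerA scale_XsubC_expjet derivMn derivC mul0rn expjet0 scaler0 add0r.
  by rewrite seqmodCE /expjet /= hornerMn (hornerC 1) /gamma mulrA.
have [jr ji] := is_cjet_expjet 'X^k.
(* The hypothesis concerns real jets, so it is applied to the real and imaginary parts of [W]
   separately. *)
have re0 : complex.Re (gamma * cexp t) @[t --> +oo] --> (0 : R).
  have := conv _ jr; rewrite -/W; under [X in X @ _ --> _]eq_fun do
    rewrite -seq_re_real /seq_re hW.
  by apply=> t; rewrite -seq_re_real dW; apply/funext.
have im0 : complex.Im (gamma * cexp t) @[t --> +oo] --> (0 : R).
  have := conv _ ji; rewrite -/W; under [X in X @ _ --> _]eq_fun do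
    rewrite -seq_im_real /seq_im hW.
  by apply=> t; rewrite -seq_im_real dW; apply/funext.
have gamma0 : gamma != 0 by rewrite mulf_neq0 // pnatr_eq0 -lt0n fact_gt0.
(* [N] is |gamma|^2, and |gamma e^(s t)|^2 = N e^(2 alpha t) is at least [N] for t >= 0, which
   excludes the limit 0. *)
pose N := complex.Re gamma ^+ 2 + complex.Im gamma ^+ 2.
have N0 : 0 < N.
  rewrite lt_def addr_ge0 ?sqr_ge0 // andbT; apply: contraNneq gamma0 => N0.
  rewrite eq_complex; move/eqP: N0; rewrite paddr_eq0 ?sqr_ge0 // !sqrf_eq0.
  exact.
have : complex.Re (gamma * cexp t) * complex.Re (gamma * cexp t) +
       complex.Im (gamma * cexp t) * complex.Im (gamma * cexp t) @[t --> +oo]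
       --> (0 * 0 + 0 * 0 : R) by apply: cvgD; apply: cvgM.
rewrite mul0r addr0 => /cvgrPdist_lt/(_ N N0) [T [_ small]].
pose t := Num.max (T + 1) 0.
have : T < t by rewrite lt_max ltrDl ltr01.
move/small; apply/negP; rewrite -leNgt sub0r normrN.
have -> : complex.Re (gamma * cexp t) * complex.Re (gamma * cexp t) +
       complex.Im (gamma * cexp t) * complex.Im (gamma * cexp t) =
       N * (expR (alpha * t)) ^+ 2 * (cos (beta * t) ^+ 2 + sin (beta * t) ^+ 2).
  by rewrite /N /cexp; case: (gamma) => x y /=; ring.
rewrite cos2Dsin2 mulr1 ger0_norm; last by rewrite mulr_ge0 ?sqr_ge0 // ltW.
rewrite ler_peMr ?(ltW N0) // exprn_ege1 // -expR0 ler_expR mulr_ge0 //.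
by rewrite le_max lexx orbT.
Qed.

End ExpJets.

(** * Normal rank and invariant zeros *)

Lemma unimodular_eqv_sym (K : comUnitRingType) k l (M N : 'M[K]_(k, l)) :
  unimodular_eqv M N -> unimodular_eqv N M.
Proof.
move=> [U [V [uU uV <-]]]; exists (invmx U), (invmx V).
by rewrite !unitmx_inv uU uV -!mulmxA mulmxV // mulmx1 mulKmx.
Qed.

Lemma unimodular_eqv_map (K L : comUnitRingType) (f : {rmorphism K -> L}) k l
    (M N : 'M[K]_(k, l)) :
  unimodular_eqv M N -> unimodular_eqv (map_mx f M) (map_mx f N).
Proof.
move=> [U [V [uU uV <-]]]; exists (map_mx f U), (map_mx f V).
by rewrite !unitmxE !det_map_mx !rmorph_unit -?unitmxE // !map_mxM.
Qed.

Lemma map_diag_seq_mx (F F' : fieldType) (f : {rmorphism {poly F} -> {poly F'}}) k l d :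
  map_mx f (diag_seq_mx k l d) = diag_seq_mx k l (map f d).
Proof.
apply/matrixP => i j; rewrite !mxE.
case: eqP => _; last exact: rmorph0.
have [lt|ge] := ltnP i (size d); first by rewrite (nth_map 0).
by rewrite !nth_default ?size_map // rmorph0.
Qed.

Lemma unimodular_eqv_rank (K : fieldType) k l (M N : 'M[K]_(k, l)) :
  unimodular_eqv M N -> \rank M = \rank N.
Proof.
move=> [U [V [uU uV <-]]]; rewrite mxrankMfree ?row_free_unit //.
by rewrite (eqmxMfull M) ?row_full_unit.
Qed.

Section NormRank.
Variable R : realType.
Local Notation C := R[i].
Local Notation toC := (map_poly (real_complex R)).

Lemma eval_mxE k l (M : 'M[{poly R}]_(k, l)) s :
  eval_mx M s = map_mx (horner_eval s \o toC) M.
Proof. by []. Qed.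

(** Among the naturals below [size p] one is not a root. The sign of its real part matters where a
    free Smith coordinate has to be excited by an unstable mode. *)
Lemma poly_nonroot (p : {poly C}) : p != 0 -> exists2 s, 0 <= complex.Re s & ~~ root p s.
Proof.
move=> p0; pose ss : seq C := [seq n%:R | n <- iota 0 (size p)].
have uss : uniq ss.
  by rewrite map_inj_uniq ?iota_uniq // => a b /eqP; rewrite eqr_nat => /eqP.
have [/allP h|] := boolP (all (root p) ss).
  have := max_poly_roots p0 _ uss; rewrite size_map size_iota ltnn => h'.
  by have : false by apply: h'; apply/allP.
move=> /allPn[s /mapP[n _ ->] ns]; exists n%:R => //.
by rewrite raddfMn /= ler0n.
Qed.

Lemma rank_diag_seq_le k l d s : (size d <= minn k l)%N ->
  (\rank (eval_mx (diag_seq_mx k l d : 'M[{poly R}]_(k, l)) s) <= size d)%N.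
Proof.
rewrite leq_min => /andP[rk rl]; rewrite (diag_seq_mxE (erefl _)) // eval_mxE !map_mxM.
exact: mulmx_max_rank.
Qed.

Lemma rank_diag_seq k l d s : (size d <= minn k l)%N ->
  ~~ root (toC (\prod_(a <- d) a)) s ->
  \rank (eval_mx (diag_seq_mx k l d : 'M[{poly R}]_(k, l)) s) = size d.
Proof.
move=> szd ns; apply/eqP; rewrite eqn_leq rank_diag_seq_le //=.
move: szd; rewrite leq_min => /andP[rk rl].
rewrite (diag_seq_mxE (erefl _)) // eval_mxE !map_mxM.
set D := diag_mx _; set D' := map_mx _ D.
have uD' : D' \in unitmx.
  by rewrite unitmxE det_map_mx det_diag_seq // unitfE.
rewrite -{1}(mxrank_unit uD').
rewrite !map_pid_mx.
(* Undoing the padding shows that the padded matrix has at least the rank of its invertible core. *)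
have D'E : D' = (pid_mx (size d) : 'M[C]_(size d, k)) *m
    (pid_mx (size d) *m D' *m pid_mx (size d))
              *m (pid_mx (size d) : 'M[C]_(l, size d)).
  by rewrite !mulmxA pid_mx_id // pid_mx_1 mul1mx -mulmxA pid_mx_id // pid_mx_1 mulmx1.
by rewrite {1}D'E; apply: leq_trans (mxrankM_maxl _ _) (mxrankM_maxr _ _).
Qed.

Lemma rank_le_normrank k l (M : 'M[{poly R}]_(k, l)) s :
  (\rank (eval_mx M s) <= normrank M)%N.
Proof.
have lt : (\rank (eval_mx M s) < l.+1)%N by rewrite ltnS rank_leq_col.
by rewrite /normrank (bigD1 (Ordinal lt)) ?leq_maxl //; apply/asboolP; exists s.
Qed.

Lemma normrank_le k l (M : 'M[{poly R}]_(k, l)) r :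
  (forall s, (\rank (eval_mx M s) <= r)%N) -> (normrank M <= r)%N.
Proof. by move=> h; apply/bigop.bigmax_leqP => i /asboolP[s <-]. Qed.

Lemma unimodular_eqv_normrank k l (M N : 'M[{poly R}]_(k, l)) s :
  unimodular_eqv M N -> \rank (eval_mx M s) = \rank (eval_mx N s).
Proof. by move=> /(unimodular_eqv_map (horner_eval s \o toC))/unimodular_eqv_rank. Qed.

Lemma is_smithE k l (M : 'M[{poly R}]_(k, l)) d : is_smith M d <->
  [/\ unimodular_eqv M (diag_seq_mx k l d), (size d <= minn k l)%N &
      all (fun a => a \is monic) d && sorted (@dvdp R) d].
Proof.
by split=> [[U [V [uU uV eM szd md]]] | [[U [V [uU uV eM]]] szd md]];
  [split=> //; exists U, V | exists U, V].
Qed.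

Lemma invariant_polysP k l (M : 'M[{poly R}]_(k, l)) : is_smith M (invariant_polys M).
Proof.
have [d [szd md sd] eM] := smith_form_exists M.
have sM : is_smith M d by apply/is_smithE; split=> //; rewrite sd andbT.
exact: (@xgetPex _ [::] [set d | is_smith M d] (ex_intro _ d sM)).
Qed.

Lemma monic_prod_neq0 d : all (fun a : {poly R} => a \is monic) d ->
  \prod_(a <- d) a != 0.
Proof.
by move=> /allP md; rewrite prodf_seq_neq0; apply/allP => a /md /monic_neq0.
Qed.

Lemma monic_prod_nonroot d : all (fun a : {poly R} => a \is monic) d ->
  exists s, ~~ root (toC (\prod_(a <- d) a)) s.
Proof.
move=> md; have p0 : toC (\prod_(a <- d) a) != 0 by rewrite map_poly_eq0 monic_prod_neq0.
by have [s _ ns] := poly_nonroot p0; exists s.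
Qed.

(** The rank is at most [size d] everywhere and reaches it wherever the product of the monic entries
    does not vanish. *)
Lemma normrank_eqv k l (M : 'M[{poly R}]_(k, l)) d :
  unimodular_eqv M (diag_seq_mx k l d) -> (size d <= minn k l)%N ->
  all (fun a : {poly R} => a \is monic) d -> normrank M = size d.
Proof.
move=> eM szd md; apply/eqP; rewrite eqn_leq normrank_le /=.
  have [s ns] := monic_prod_nonroot md.
  by rewrite -(rank_diag_seq szd ns) -?(unimodular_eqv_normrank _ eM) ?rank_le_normrank.
by move=> s; rewrite (unimodular_eqv_normrank _ eM) rank_diag_seq_le.
Qed.

Lemma ZinvE k l (M : 'M[{poly R}]_(k, l)) s :
  Zinv M s = mup s (\prod_(a <- map toC (invariant_polys M)) a).
Proof. by rewrite /Zinv rmorph_prod big_map. Qed.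

Variables (k l q : nat) (P : 'M[{poly R}]_(k, l)) (G : 'M[{poly R}]_(q, l)).
Variables (d : seq {poly R}) (U : 'M[{poly R}]_k) (V : 'M[{poly R}]_l).
Hypotheses (uU : U \in unitmx) (uV : V \in unitmx).
Hypothesis eP : U *m P *m V = diag_seq_mx k l d.
Hypothesis szd : (size d <= minn k l)%N.
Hypothesis md : all (fun a => a \is monic) d.
Let H := G *m V.

Lemma col_mx_eqv : unimodular_eqv (col_mx P G) (col_mx (diag_seq_mx k l d) H).
Proof.
exists (block_mx U 0 0 1%:M), V; split=> //.
  by rewrite unitmxE det_ublock det1 mulr1 -unitmxE.
by rewrite mul_block_col !mul0mx addr0 add0r mul1mx mul_col_mx eP.
Qed.

Lemma normrank_col_mx : normrank P = normrank (col_mx P G) <->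
  forall i (j : 'I_l), (size d <= j)%N -> H i j = 0.
Proof.
have eM : unimodular_eqv P (diag_seq_mx k l d) by exists U, V.
have nP := normrank_eqv eM szd md.
move: szd; rewrite leq_min => /andP[rk rl].
split=> [nPe i j lej | H0].
  apply/eqP/negPn/negP => Hij.
  (* At a common nonroot [s] of the invariant polynomials and of [H i j], equal ranks put the rows
     of H(s) in the row space of the diagonal, whose columns from [size d] on are zero. *)
  have pH0 : toC (\prod_(a <- d) a * H i j) != 0.
    by rewrite map_poly_eq0 mulf_neq0 // monic_prod_neq0.
  have [s _] := poly_nonroot pH0; rewrite rmorphM rootM negb_or => /andP[ds Hs].
  have := rank_le_normrank (col_mx P G) s.
  rewrite -nPe nP (unimodular_eqv_normrank _ col_mx_eqv).
  rewrite -(rank_diag_seq szd ds) eval_mxE map_col_mx -!eval_mxE => le.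
  have sub : (eval_mx (diag_seq_mx k l d) s <=
    col_mx (eval_mx (diag_seq_mx k l d) s) (eval_mx H s))%MS.
    by rewrite -addsmxE addsmxSl.
  have := mxrank_leqif_sup sub => /leqifP; case: ifP => [|_]; last by rewrite ltnNge le.
  rewrite -addsmxE addsmx_sub => /andP[_ /submxP[Y HY]] _.
  move/negP: Hs; apply; rewrite /root; apply/eqP.
  have := congr1 (fun Z : 'M[C]_(q, l) => Z i j) HY; rewrite mxE /= => ->.
  rewrite (diag_seq_mxE (erefl _)) // [eval_mx]lock mxE big1 // => t _.
  rewrite -lock eval_mxE map_mxM mxE [X in _ * X]big1 ?mulr0 // => t' _.
  have /negbTE t'j : t' != j :> nat by rewrite neq_ltn (leq_trans (ltn_ord t') lej).
  by rewrite map_pid_mx !mxE t'j /= mulr0.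
apply/eqP; rewrite nP eqn_leq; apply/andP; split.
  have [s ns] := monic_prod_nonroot md.
  apply: leq_trans (rank_le_normrank _ s).
  rewrite -[leqLHS](@rank_diag_seq k l _ s) //.
  rewrite -(unimodular_eqv_normrank _ eM) [in leqRHS]eval_mxE map_col_mx -addsmxE.
  exact/mxrankS/addsmxSl.
apply: normrank_le => s; rewrite (unimodular_eqv_normrank _ col_mx_eqv).
rewrite (diag_seq_mxE (erefl _)) // -(mulmx_pid_id H0) -mul_col_mx eval_mxE map_mxM.
exact: mulmx_max_rank.
Qed.

(** The real Smith forms stay equivalent over C[X], where multiplicities are compared. Equality of
    normal ranks provides equal lengths and the zero columns of [H]. *)
Lemma Zinv_col_mx s : d = invariant_polys P -> normrank P = normrank (col_mx P G) ->
  Zinv P s = Zinv (col_mx P G) s <->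
  forall i (j : 'I_l), ('X - s%:P) ^+ mup s (toC d`_j) %| toC (H i j).
Proof.
move=> dE nPe; rewrite !ZinvE -dE; set d' := invariant_polys _.
have eP' : unimodular_eqv P (diag_seq_mx k l d) by exists U, V.
have /is_smithE[ePe szd' /andP[md' _]] := invariant_polysP (col_mx P G).
rewrite -/d' in ePe szd' md'.
have eqsz : size d = size d'.
  by rewrite -(normrank_eqv eP' szd md) -(normrank_eqv ePe szd' md').
have H0 := (iffLR normrank_col_mx) nPe.
have := unimodular_eqv_map (map_poly (real_complex R))
  (unimodular_eqv_trans (unimodular_eqv_sym col_mx_eqv) ePe).
rewrite map_col_mx !map_diag_seq_mx => eC.
have n0 (e : seq {poly R}) : all (fun a => a \is monic) e -> 0 \notin map toC e.
  move=> /allP me; apply/mapP => -[a /me /monic_neq0 a0 /esym/eqP].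
  by rewrite map_poly_eq0 (negbTE a0).
have := @smith_mup_compare C k q l (map toC d) (map toC d') (map_mx toC H) s
  _ _ (n0 _ md) (n0 _ md') _ eC.
rewrite !size_map => cmp; rewrite cmp // => [|i j lej]; last by rewrite mxE H0 // rmorph0.
have nE (j : 'I_l) : (map toC d)`_j = toC d`_j.
  have [lt|ge] := ltnP j (size d); first by rewrite (nth_map 0).
  by rewrite !nth_default ?size_map // rmorph0.
by split=> dv i j; have := dv i j; rewrite nE [map_mx _ _ _ _]mxE.
Qed.

End NormRank.

(** * Trajectories *)

Section VectorJets.
Variable R : realType.

Lemma col_cvg0P q (f : R -> 'cV[R]_q) :
  (f t @[t --> +oo] --> (0 : 'cV[R]_q)) <->
  (forall i, f t i 0 @[t --> +oo] --> (0 : R)).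
Proof.
split=> [f0 i | f0].
  have := cvg_comp _ _ f0 (@coord_continuous R q 1 i 0 0); rewrite mxE; exact.
apply/cvgrPdist_le => e e0; near=> t.
rewrite /Num.Def.normr /= mx_normrE (bigmax_le _ (ltW e0)) //= => i _.
rewrite !mxE ord1 /=; move: i; near: t; apply: filter_forall => i.
have /cvgrPdist_le/(_ e e0) := f0 i.1; exact.
Unshelve. all: by end_near.
Qed.

(** At t > 0 the constraint 0 <= t + h holds as soon as |h| < t, so the derivative is two-sided. *)
Lemma deriv_ge0_is_derive k (f g : R -> 'cV[R]_k) : deriv_ge0 f g ->
  forall t : R, 0 < t -> forall i, is_derive t (1 : R) (fun t => f t i 0) (g t i 0).
Proof.
move=> dfg t t0 i.
suff fg : h^-1 *: (f (h *: (1 : R) + t) i 0 - f t i 0) @[h --> (0 : R)^'] --> g t i 0.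
  by apply: DeriveDef; [by apply/cvg_ex; exists (g t i 0) | exact: cvg_lim].
move=> Q Qg.
have WQ : \forall h \near (0 : R)^', 0 <= t + h -> Q ((h^-1 *: (f (t + h) - f t)) i 0).
  exact: (cvg_comp _ _ (dfg t (ltW t0)) (@coord_continuous R k 1 i 0 (g t)) Q Qg).
have pos : \forall h \near (0 : R)^', `|h| < t by exact: dnbhs0_lt.
change (\forall h \near (0 : R)^', Q (h^-1 *: (f (h *: (1 : R) + t) i 0 - f t i 0))).
apply: filterS2 WQ pos => h Qh ht.
have := Qh _; rewrite /= !mxE [h *: 1]mulr1 [h + t]addrC; apply.
by rewrite -lerBlDl sub0r; move: ht; rewrite ltr_norml => /andP[/ltW].
Qed.

Lemma is_derive_deriv_ge0 k (f g : R -> 'cV[R]_k) :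
  (forall (t : R) i, is_derive t (1 : R) (fun t => f t i 0) (g t i 0)) -> deriv_ge0 f g.
Proof.
move=> dfg t t0.
have df : derivable f t 1.
  by apply/derivable_mxP => i j; rewrite ord1; have [] := dfg t i.
have -> : g t = 'D_1 f t.
  rewrite derive_mx //; apply/matrixP => i j; rewrite mxE ord1.
  by rewrite derive_val.
have fD : h^-1 *: (f (h *: (1 : R) + t) - f t) @[h --> (0 : R)^'] --> 'D_1 f t by exact: df.
have -> : (fun h : R => h^-1 *: (f (t + h) - f t)) =
          (fun h : R => h^-1 *: (f (h *: (1 : R) + t) - f t)).
  by apply/funext => h; rewrite [h *: 1]mulr1 [h + t]addrC.
exact: cvg_trans (cvg_app _ (cvg_within _)) fD.
Qed.

(** The half-line is open, so each derivative is locally the derivative of the zero function. *)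
Lemma is_jet_eq0 (w : R -> seqmod R) : is_jet [set t | 0 < t] w ->
  (forall t, 0 < t -> w t 0%N = 0) -> forall t, 0 < t -> w t = 0.
Proof.
move=> jw w0 t t0; apply/funext => j; elim: j t t0 => [|j IHj] t t0; first exact: w0.
have dw := jw t t0 j; rewrite -[LHS](@derive_val _ _ _ _ _ _ _ dw).
rewrite (@near_eq_derive _ _ _ _ (cst 0)) ?derive_cst ?oner_eq0 //.
near=> u; apply: IHj; near: u; exact: lt_nbhsr.
Unshelve. all: by end_near.
Qed.

Lemma smooth_ge0_jets k (w : 'I_k -> R -> seqmod R) : (forall i, is_jet setT (w i)) ->
  smooth_ge0 (fun t => \col_i w i t 0%N).
Proof.
move=> jw; exists (fun j t => \col_i w i t j); split=> // j.
apply: is_derive_deriv_ge0 => t i; rewrite mxE.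
under eq_fun do rewrite mxE; exact: jw.
Qed.

Lemma is_jet_mx_act D k l (Q : 'M[{poly R}]_(k, l)) (w : R -> 'I_l -> seqmod R) :
  (forall i, is_jet D (w ^~ i)) -> forall i, is_jet D (fun t => mx_act Q (w t) i).
Proof. by move=> jw i; apply: is_jet_sum => j; exact/is_jetZ/jw. Qed.

End VectorJets.

(** * The system matrix as a differential operator *)

Section SystemAction.
Variables (R : realType) (n m p : nat).
Variables (A : 'M[R]_n) (B : 'M[R]_(n, m)) (C : 'M[R]_(p, n)) (D : 'M[R]_(p, m)).
Implicit Types w : 'I_(n + m) -> seqmod R.

Definition state_part w j : 'cV[R]_n := \col_i w (lshift m i) j.
Definition input_part w j : 'cV[R]_m := \col_i w (rshift n i) j.

Lemma mx_act_row_mx k (Q : 'M[R]_(k, n)) (S : 'M[R]_(k, m)) w i j :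
  mx_act (row_mx (map_mx polyC Q) (map_mx polyC S)) w i j =
  (Q *m state_part w j + S *m input_part w j) i 0.
Proof.
rewrite /mx_act seqmod_sumE big_split_ord !mxE; congr (_ + _); apply: eq_bigr => t _.
  by rewrite row_mxEl !mxE seqmodCE.
by rewrite row_mxEr !mxE seqmodCE.
Qed.

Lemma mx_act_sysP_top w i j :
  mx_act (sysP A B C D) w (lshift p i) j =
  (state_part w j.+1 - (A *m state_part w j + B *m input_part w j)) i 0.
Proof.
rewrite /mx_act seqmod_sumE big_split_ord /= !mxE opprD addrA; congr (_ + _).
  rewrite (eq_bigr (fun t => (t == i)%:R * w (lshift m t) j.+1
                             - A i t * state_part w j t 0)) => [|t _].
    rewrite sumrB (bigD1 i) //= eqxx mul1r big1 ?addr0 // => t /negbTE ->.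
    by rewrite mul0r.
  rewrite block_mxEul !mxE scalerBl seqmodDE seqmodNE seqmodCE eq_sym; congr (_ - _).
  by case: eqP => _; rewrite ?mulr1n ?mulr0n ?scale0r ?mul0r ?mul1r ?seqmodXE.
rewrite -sumrN; apply: eq_bigr => t _.
by rewrite block_mxEur !mxE scaleNr seqmodNE seqmodCE.
Qed.

Lemma mx_act_sysP_bot w i j :
  mx_act (sysP A B C D) w (rshift n i) j =
  (C *m state_part w j + D *m input_part w j) i 0.
Proof.
rewrite -mx_act_row_mx /mx_act !seqmod_sumE; apply: eq_bigr => t _.
by rewrite [sysP _ _ _ _ _ _]col_mxEd.
Qed.

Lemma mx_act_diag k l (d : seq {poly R}) (w : 'I_l -> seqmod R) (i : 'I_k) (j : 'I_l) :
  i = j :> nat -> mx_act (diag_seq_mx k l d) w i = d`_j *: w j.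
Proof.
move=> ij; rewrite /mx_act (bigD1 j) //= big1 => [|t tj].
  by rewrite mxE ij eqxx addr0.
have /negbTE jt : j != t :> nat by rewrite eq_sym.
by rewrite mxE ij jt scale0r.
Qed.

End SystemAction.

Lemma mx_act_single (K : comNzRingType) k l (Q : 'M[{poly K}]_(k, l)) j a i :
  mx_act Q (fun j' => if j' == j then a else 0) i = Q i j *: a.
Proof.
rewrite /mx_act (bigD1 j) //= eqxx big1 ?addr0 // => t /negbTE ->.
exact: scaler0.
Qed.

(** * Detectability in Smith coordinates *)

Section Detectability.
Variables (R : realType) (n m p q : nat).
Variables (A : 'M[R]_n) (B : 'M[R]_(n, m)) (C : 'M[R]_(p, n)) (D : 'M[R]_(p, m)).
Variables (E : 'M[R]_(q, n)) (F : 'M[R]_(q, m)).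
Local Notation toC := (map_poly (real_complex R)).
Local Notation P := (sysP A B C D).
Local Notation G := (row_mx (map_mx polyC E) (map_mx polyC F)).
Variables (d : seq {poly R}) (U : 'M[{poly R}]_(n + p)) (V : 'M[{poly R}]_(n + m)).
Hypotheses (uU : U \in unitmx) (uV : V \in unitmx).
Hypothesis eP : U *m P *m V = diag_seq_mx (n + p) (n + m) d.
Hypothesis szd : (size d <= minn (n + p) (n + m))%N.
Hypothesis md : all (fun a => a \is monic) d.
Let H := G *m V.

(** Placed in the j-th Smith coordinate, [w] is carried by [V] to an impulse-free trajectory with y
    = 0 and z_i = H_ij(d/dt) w. For j >= [size d] the default d_j = 0 leaves [w] free. *)
Lemma detectable_vanishes i (j : 'I_(n + m)) (w : R -> seqmod R) :
  strongly_functional_detectable A B C D E F ->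
  is_jet setT w -> (forall t, d`_j *: w t = 0) ->
  (H i j *: w t) 0%N @[t --> +oo] --> (0 : R).
Proof.
move=> sfd jw dw.
pose e (t : R) := fun j' : 'I_(n + m) => if j' == j then w t else 0.
pose W t := mx_act V (e t).
have jW : forall i, is_jet setT (W ^~ i).
  apply: is_jet_mx_act => j'; rewrite /e; case: (j' == j) => // t _ k.
  exact: is_derive_cst.
have PW t i' : mx_act P (W t) i' = 0.
  rewrite /W -mx_actM -[P *m V](mulKmx uU) (mulmxA U) eP mx_actM.
  apply: mx_act_cst0 => i1; rewrite mx_act_single mxE; case: eqP => [->|_] //.
  by rewrite scale0r.
have GW t : mx_act G (W t) i = H i j *: w t by rewrite -mx_actM mx_act_single.
have state_eq t : state_part (W t) 1 =
    A *m state_part (W t) 0 + B *m input_part (W t) 0.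
  apply/eqP; rewrite -subr_eq0; apply/eqP/colP => i'.
  by rewrite -(mx_act_sysP_top _ _ C D) PW mxE.
pose u := Signal (fun t => input_part (W t) 0) 0.
pose x := Signal (fun t => state_part (W t) 0) 0.
pose y := sig_add (sig_mul C x) (sig_mul D u).
pose z := sig_add (sig_mul E x) (sig_mul F u).
have out_smooth k (Q : 'M[R]_(k, n)) (S : 'M[R]_(k, m)) :
    impulsive_smooth (sig_add (sig_mul Q x) (sig_mul S u)).
  rewrite /impulsive_smooth /= [X in smooth_ge0 X](_ : _ = fun t =>
    \col_i (mx_act (row_mx (map_mx polyC Q) (map_mx polyC S)) (W t) i) 0%N).
    exact: (smooth_ge0_jets (is_jet_mx_act (row_mx (map_mx polyC Q) (map_mx polyC S)) jW)).
  by apply/funext => t; apply/colP => i'; rewrite [RHS]mxE mx_act_row_mx.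
(* With initial state x(0), the jump of the state at 0 matches the Dirac term, so no impulses are
   needed. *)
have traj : trajectory A B C D E F (state_part (W 0) 0) u x y z.
  split.
  - split; [| | exact: out_smooth | exact: out_smooth].
      exact: (smooth_ge0_jets (fun i => jW (rshift n i))).
    exact: (smooth_ge0_jets (fun i => jW (lshift m i))).
  - split=> /=; last by rewrite !mulmx0 scaler0 addr0.
    apply: is_derive_deriv_ge0 => t i'; rewrite addr0 -state_eq mxE.
    under eq_fun do rewrite mxE; exact: jW.
  - by [].
  - by [].
have := sfd _ _ _ _ _ traj => /= zlim.
have y0 t : 0 < t -> reg y t = 0.
  by move=> _; apply/colP => i'; rewrite -(mx_act_sysP_bot A B) PW mxE.
have /col_cvg0P/(_ i) := zlim y0.
by under eq_fun do rewrite -mx_act_row_mx GW.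
Qed.

(** Necessity tests single unstable modes. Sufficiency passes to the coordinates V^-1 (x; u), where
    each of the first [size d] solves its own scalar equation and the others do not enter z. *)
Lemma detectable_iff : strongly_functional_detectable A B C D E F <->
  (forall i (j : 'I_(n + m)), (size d <= j)%N -> H i j = 0) /\
  (forall s : R[i], 0 <= complex.Re s ->
     forall i (j : 'I_(n + m)), ('X - s%:P) ^+ mup s (toC d`_j) %| toC (H i j)).
Proof.
split=> [sfd | [H0 Hd]].
  split=> [i j lej | s s0 i j]; have conv w := @detectable_vanishes i j w sfd.
    apply/eqP/negPn/negP => Hij.
    have HijC : toC (H i j) != 0 by rewrite map_poly_eq0.
    have [s s0 _] := poly_nonroot HijC.
    apply: (@unstable_quotient R s d`_j (H i j)) => //.
    (* The default entry 0 is divisible by every power of X - s, so any unstable [s] serves. *)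
    by rewrite nth_default // rmorph0 dvdp0.
  have [->|Hij] := eqVneq (H i j) 0; first by rewrite rmorph0 dvdp0.
  have HijC : toC (H i j) != 0 by rewrite map_poly_eq0.
  rewrite -mup_geq // leqNgt; apply/negP => lt.
  apply: (@unstable_quotient R s d`_j (H i j)) => //.
  apply: dvdp_trans (mup_exp_dvd _ s); exact: dvdp_exp2l.
move=> x0 u x y z [[[Gu [Gu0 dGu]] [Gx [Gx0 dGx]] _ _] [dx _] [yE _] [zE _]] y0.
pose W (t : R) (i : 'I_(n + m)) : seqmod R := fun j => col_mx (Gx j t) (Gu j t) i 0.
have stateW t j : state_part (W t) j = Gx j t.
  by apply/colP => i; rewrite mxE /W col_mxEu.
have inputW t j : input_part (W t) j = Gu j t.
  by apply/colP => i; rewrite mxE /W col_mxEd.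
have jW (i : 'I_(n + m)) : is_jet [set t | 0 < t] (W ^~ i).
  move=> t t0 j; rewrite /W -(fintype.splitK i); case: (fintype.split i) => i' /=.
    rewrite col_mxEu; under eq_fun do rewrite col_mxEu.
    exact: deriv_ge0_is_derive (dGx j) _ t0 i'.
  rewrite col_mxEd; under eq_fun do rewrite col_mxEd.
  exact: deriv_ge0_is_derive (dGu j) _ t0 i'.
have PW t (i : 'I_(n + p)) : 0 < t -> mx_act P (W t) i = 0.
  (* Only the equations themselves have to be checked; their derivatives follow on the open
     half-line. *)
  apply: (is_jet_eq0 (is_jet_mx_act P jW i)) => {}t t0; rewrite -(fintype.splitK i).
  case: (fintype.split i) => i' /=.
    rewrite mx_act_sysP_top !stateW inputW Gx0 Gu0.
    have := deriv_ge0_is_derive (dGx 0%N) t0 i'; rewrite Gx0 => -[_ d1].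
    have := deriv_ge0_is_derive dx t0 i' => -[_].
    rewrite d1 /= addr0 => dE.
    by rewrite mxE [X in _ + X]mxE dE subrr.
  rewrite mx_act_sysP_bot stateW inputW Gx0 Gu0.
  by have := yE t (ltW t0); rewrite y0 //= => <-; rewrite mxE.
apply/col_cvg0P => i.
pose Om t := mx_act (invmx V) (W t).
have dOm t (j : 'I_(n + m)) : 0 < t -> (j < size d)%N -> d`_j *: Om t j = 0.
  move=> t0 ltj; have ltjk : (j < n + p)%N.
    by apply: leq_trans ltj _; move: szd; rewrite leq_min => /andP[].
  rewrite -(@mx_act_diag _ (n + p) _ _ _ (Ordinal ltjk)) // -eP /Om -mx_actM.
  rewrite mulmxK // mx_actM; apply: mx_act_cst0 => i'; exact: PW.
have jOm j : is_jet [set t | 0 < t] (Om ^~ j) by exact: (is_jet_mx_act (invmx V) jW j).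
have zHOm : \forall t \near +oo, reg z t i 0 = \sum_j (H i j *: Om t j) 0%N.
  near=> t; have t0 : 0 < t by near: t; exact: nbhs_pinfty_gt.
  rewrite zE ?ltW //= -Gx0 -Gu0 -stateW -inputW -mx_act_row_mx.
  by rewrite -[G](mulmxK uV) mx_actM -/(Om t) /mx_act seqmod_sumE.
have sum0 : \sum_j (H i j *: Om t j) 0%N @[t --> +oo] --> (0 : R).
  have : \sum_j (H i j *: Om t j) 0%N @[t --> +oo] --> (\sum_(j < n + m) 0 : R).
    apply: cvg_big => [|j _]; first exact: add_continuous.
    have [lej|ltj] := leqP (size d) j.
      by under eq_fun do rewrite H0 // scale0r; exact: cvg_cst.
    apply: (@stable_quotient _ d`_j) => //.
    - by apply: monic_neq0; move/allP: md; apply; rewrite mem_nth.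
    - by move=> s s0; exact: Hd.
    - by move=> t t0; exact: dOm.
  by rewrite big1.
apply: cvg_trans sum0; apply: near_eq_cvg.
by near=> t; apply/esym; near: t.
Unshelve. all: by end_near.
Qed.

End Detectability.

Theorem theorem9 (R : realType) (n m p q : nat)
    (A : 'M[R]_n) (B : 'M[R]_(n, m)) (C : 'M[R]_(p, n)) (D : 'M[R]_(p, m))
    (E : 'M[R]_(q, n)) (F : 'M[R]_(q, m)) :
  strongly_functional_detectable A B C D E F <->
  normrank (sysP A B C D) = normrank (sysPe A B C D E F) /\
  Zinv_plus (sysP A B C D) =1 Zinv_plus (sysPe A B C D E F).
Proof.
have [U [V [uU uV eP szd /andP[md _]]]] := invariant_polysP (sysP A B C D).
rewrite (detectable_iff E F uU uV eP szd md) /sysPe.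
have nrk := normrank_col_mx (row_mx (map_mx polyC E) (map_mx polyC F)) uU uV eP szd md.
split=> [[H0 Hd] | [nPe Zeq]].
  (* The rank equality comes first because the comparison of zeros presupposes it. *)
  have nPe := iffRL nrk H0; split=> // s; rewrite /Zinv_plus; case: ifP => // s0.
  by apply/(Zinv_col_mx uU uV eP szd md s erefl nPe); exact: Hd.
split; first exact: (iffLR nrk nPe).
move=> s s0; apply/(Zinv_col_mx uU uV eP szd md s erefl nPe).
by have := Zeq s; rewrite /Zinv_plus s0.
Qed.
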